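(* Suppose $U$ is a normal measure on a measurable cardinal $\kappa$. Then $\kappa$ is $L_{\kappa^+,\kappa^+}$-indescribable and the set \[\{\alpha<\kappa:\ \alpha\text{ is }L_{\alpha^+,\alpha^+}\text{-indescribable}\}\] is in $U$.
   Context: Canonical functions. For every regular cardinal $\kappa$ and every ordinal $\xi$ with $\kappa\le\xi<\kappa^+$ fix a bijection $b_{\kappa,\xi}:\kappa\to\xi$, with $b_{\kappa,\kappa}=\mathrm{id}_\kappa$. For $\xi<\kappa^+$ and $\alpha<\kappa$ let $F^\kappa_\xi(\alpha)=\xi$ if $\xi<\kappa$, and $F^\kappa_\xi(\alpha)=b_{\kappa,\xi}[\alpha]$ if $\kappa\le\xi<\kappa^+$. Let $f^\kappa_\xi(\alpha)=\mathrm{ot}(F^\kappa_\xi(\alpha))$ and let $\pi^\kappa_{\xi,\alpha}:F^\kappa_\xi(\alpha)\to f^\kappa_\xi(\alpha)$ be the transitive collapse. $L_{\kappa^+,\kappa^+}$ is the infinitary logic allowing conjunctions of at most $\kappa$ many formulas and simultaneous quantification over at most $\kappa$ many variables. Formulas are built from atomic formulas by negation, conjunctions $\bigwedge_{\zeta<\xi}\varphi_\zeta$ ($\xi<\kappa^+$), and existential quantification; the supply of variables is $\{x_\eta:\eta<\kappa\}$, so that existential formulas have the form $\exists\langle x_{\alpha_\eta}:\eta<\gamma\rangle\psi$ with $\gamma\le\kappa$ and $\langle\alpha_\eta:\eta<\gamma\rangle$ an increasing sequence of ordinals less than $\kappa$. For each cardinal $\alpha<\kappa$, the formulas of $L_{\alpha^+,\alpha^+}$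 use the variables $\{x_\eta:\eta<\alpha\}$. Restriction. For $\kappa$ regular and $\alpha<\kappa$ a cardinal, $\varphi|^\kappa_\alpha$ is defined for $L_{\kappa^+,\kappa^+}$ formulas $\varphi$ by recursion on subformulas: (1) if $\varphi$ is atomic, $\varphi|^\kappa_\alpha=\varphi$; (2) $(\lnot\psi)|^\kappa_\alpha=\lnot(\psi|^\kappa_\alpha)$; (3) $\left(\bigwedge_{\zeta<\xi}\varphi_\zeta\right)|^\kappa_\alpha=\bigwedge_{\zeta<f^\kappa_\xi(\alpha)}\varphi_{(\pi^\kappa_{\xi,\alpha})^{-1}(\zeta)}|^\kappa_\alpha$, provided this is a formula of $L_{\alpha^+,\alpha^+}$, and undefined otherwise; (4) $\left(\exists\langle x_{\alpha_\eta}:\eta<\gamma\rangle\psi\right)|^\kappa_\alpha=\exists\langle x_{\alpha_\eta}:\eta<\alpha\cap\gamma\rangle\,(\psi|^\kappa_\alpha)$, provided this is a formula of $L_{\alpha^+,\alpha^+}$, and undefined otherwise. A regular cardinal $\kappa$ is $L_{\kappa^+,\kappa^+}$-indescribable if for every sentence $\varphi$ of $L_{\kappa^+,\kappa^+}$ in the language of set theory, if $V_\kappa\models\varphi$ then there is some $\alpha<\kappa$ such that $V_\alpha\models\varphi|^\kappa_\alpha$ (which includes that $\varphi|^\kappa_\alpha$ is defined). (This does not depend on the choice of the bijections.) *)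

(* Defs.v *)
From Stdlib Require Import Classical ClassicalEpsilon FunctionalExtensionality
  PropExtensionality.

Set Implicit Arguments.
Unset Strict Implicit.
Unset Printing Implicit Defensive.

(** Second-order ZFC: foundation and replacement range over arbitrary
    predicates, so that relations and functions of Rocq restricted to a set are
    sets.  Relations in [replacement] may be partial, which gives separation. *)
Record ZFC : Type := {
  carrier :> Type;
  mem : carrier -> carrier -> Prop;
  extensionality : forall x y, (forall z, mem z x <-> mem z y) -> x = y;
  foundation : well_founded mem;
  pairing : forall x y, exists p, forall z, mem z p <-> z = x \/ z = y;
  union : forall x, exists u, forall z, mem z u <-> exists y, mem y x /\ mem z y;
  powerset : forall x, exists p,
    forall y, mem y p <-> forall z, mem z y -> mem z x;
  infinity : exists w,
    (exists e, mem e w /\ forall z, ~ mem z e) /\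
    (forall x, mem x w ->
       exists y, mem y w /\ forall z, mem z y <-> mem z x \/ z = x);
  replacement : forall (R : carrier -> carrier -> Prop) x,
    (forall u v v', mem u x -> R u v -> R u v' -> v = v') ->
    exists y, forall v, mem v y <-> exists u, mem u x /\ R u v;
  choice : forall x,
    (forall y, mem y x -> exists z, mem z y) ->
    (forall y y' z, mem y x -> mem y' x -> mem z y -> mem z y' -> y = y') ->
    exists c, forall y, mem y x -> exists! z, mem z y /\ mem z c
}.

Arguments mem {_} _ _.
Notation "x ∈ y" := (mem x y) (at level 70, no associativity).

Definition el {V : ZFC} (x : V) : Type := {y : V | y ∈ x}.
Definition val {V : ZFC} {x : V} (z : el x) : V := proj1_sig z.
Coercion val : el >-> carrier.

(** [ZFC] is inhabited: Aczel's sets modulo extensional equality form a model. *)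

Module AczelModel.

Inductive tree : Type := sup (A : Type) (f : A -> tree).

Fixpoint teq (x y : tree) : Prop :=
  match x, y with
  | sup f, sup g =>
      (forall a, exists b, teq (f a) (g b)) /\
      (forall b, exists a, teq (f a) (g b))
  end.

Definition tmem (x y : tree) : Prop :=
  match y with sup g => exists b, teq x (g b) end.

Lemma teq_refl x : teq x x.
Proof. induction x as [A f IH]; split; intros a; exists a; apply IH. Qed.

Lemma teq_sym x : forall y, teq x y -> teq y x.
Proof.
induction x as [A f IH]; intros [B g] [H1 H2]; split.
- intros b. destruct (H2 b) as [a Ha]. exists a. now apply IH.
- intros a. destruct (H1 a) as [b Hb]. exists b. now apply IH.
Qed.

Lemma teq_trans x : forall y z, teq x y -> teq y z -> teq x z.
Proof.
induction x as [A f IH]; intros [B g] [C h] [H1 H2] [H3 H4]; split.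
- intros a. destruct (H1 a) as [b Hb]. destruct (H3 b) as [c Hc].
  exists c. now apply IH with (g b).
- intros c. destruct (H4 c) as [b Hb]. destruct (H2 b) as [a Ha].
  exists a. now apply IH with (g b).
Qed.

Definition aset : Type := {P : tree -> Prop | exists x, P = teq x}.
Definition cl (x : tree) : aset := exist _ (teq x) (ex_intro _ x eq_refl).

Lemma cl_eq x y : cl x = cl y <-> teq x y.
Proof.
split.
- intros H. apply (f_equal (@proj1_sig _ _)) in H. simpl in H.
  rewrite H. apply teq_refl.
- intros H. assert (E : teq x = teq y).
  { apply functional_extensionality. intros z. apply propositional_extensionality.
    split; intros H'.
    - apply teq_trans with x; auto using teq_sym.
    - apply teq_trans with y; auto. }
  unfold cl. apply eq_sig_hprop; simpl; auto.
  intros P p q. apply proof_irrelevance.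
Qed.

Lemma cl_surj (s : aset) : exists x, s = cl x.
Proof.
destruct s as [P [x Hx]]. exists x. apply eq_sig_hprop; simpl; auto.
intros Q p q. apply proof_irrelevance.
Qed.

Definition rep (s : aset) : tree :=
  proj1_sig (constructive_indefinite_description _ (cl_surj s)).

Lemma cl_rep s : cl (rep s) = s.
Proof.
symmetry. exact (proj2_sig (constructive_indefinite_description _ (cl_surj s))).
Qed.

Definition amem (s t : aset) : Prop := exists x, s = cl x /\ tmem x (rep t).

Lemma amem_sup s A (f : A -> tree) : amem s (cl (sup f)) <-> exists a, s = cl (f a).
Proof.
unfold amem. assert (H := proj1 (cl_eq _ _) (cl_rep (cl (sup f)))).
destruct (rep (cl (sup f))) as [B g]. destruct H as [H1 H2]. simpl. split.
- intros [x [-> [b Hb]]]. destruct (H1 b) as [a Ha]. exists a.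
  apply cl_eq. now apply teq_trans with (g b).
- intros [a ->]. destruct (H2 a) as [b Hb]. exists (f a). split; auto.
  exists b. now apply teq_sym.
Qed.

Lemma is_sup s : exists A (f : A -> tree), s = cl (sup f).
Proof. destruct (cl_surj s) as [[A f] ->]. now exists A, f. Qed.

Definition model : ZFC.
Proof.
refine (@Build_ZFC aset amem _ _ _ _ _ _ _ _).
- intros s t H. destruct (is_sup s) as [A [f ->]], (is_sup t) as [B [g ->]].
  apply cl_eq. split.
  + intros a. destruct (proj1 (amem_sup (cl (f a)) g)) as [b Hb].
    * apply H. apply amem_sup. now exists a.
    * exists b. now apply cl_eq.
  + intros b. destruct (proj1 (amem_sup (cl (g b)) f)) as [a Ha].
    * apply H. apply amem_sup. now exists b.
    * exists a. now apply cl_eq.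
- intros s. destruct (cl_surj s) as [x ->]. induction x as [A f IH].
  constructor. intros t Ht. apply amem_sup in Ht. now destruct Ht as [a ->].
- intros s t. exists (cl (sup (fun c : bool => if c then rep s else rep t))).
  intros z. rewrite amem_sup. split.
  + intros [[|] ->]; rewrite cl_rep; auto.
  + intros [-> | ->]; [exists true | exists false]; now rewrite cl_rep.
- intros s. destruct (is_sup s) as [A [f ->]].
  exists (cl (sup (fun p : {a : A & match f a with @sup B _ => B end} =>
      match f (projT1 p) as x return match x with @sup B _ => B end -> tree with
      | sup g => g end (projT2 p)))).
  intros z. rewrite amem_sup. split.
  + intros [[a b] ->]. exists (cl (f a)). rewrite amem_sup. split; [now exists a|].
    simpl. destruct (f a) as [B g]. apply amem_sup. now exists b.
  + intros [y [Hy Hz]]. apply amem_sup in Hy. destruct Hy as [a ->].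
    assert (E : exists b : match f a with @sup B _ => B end, z = cl
      (match f a as x return match x with @sup B _ => B end -> tree with
       | sup g => g end b)).
    { destruct (f a) as [B g]. now apply amem_sup. }
    destruct E as [b ->]. now exists (existT _ a b).
- intros s. destruct (is_sup s) as [A [f ->]].
  exists (cl (sup (fun P : A -> Prop => sup (fun p : {a | P a} => f (proj1_sig p))))).
  intros t. rewrite amem_sup. split.
  + intros [P ->] z Hz. apply amem_sup in Hz. destruct Hz as [[a Ha] ->].
    apply amem_sup. now exists a.
  + intros H. destruct (is_sup t) as [B [g ->]].
    exists (fun a => exists b, teq (f a) (g b)). apply cl_eq. split.
    * intros b. destruct (proj1 (amem_sup (cl (g b)) f)) as [a Ha].
      { apply H. apply amem_sup. now exists b. }
      apply cl_eq in Ha.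
      exists (exist _ a (ex_intro _ b (teq_sym Ha))). exact Ha.
    * intros [a [b Hb]]. exists b. now apply teq_sym.
- pose (num := nat_rect (fun _ => tree) (sup (fun e : Empty_set => match e with end))
    (fun _ x => sup (fun o : option (match x with @sup A _ => A end) =>
       match o with
       | None => x
       | Some a => match x as x return match x with @sup A _ => A end -> tree with
                   | sup f => f end a
       end))).
  exists (cl (sup num)). split.
  + exists (cl (num 0)). rewrite amem_sup. split; [now exists 0|].
    intros z Hz. simpl in Hz. apply amem_sup in Hz. now destruct Hz as [[] _].
  + intros x Hx. apply amem_sup in Hx. destruct Hx as [n ->].
    exists (cl (num (S n))). rewrite amem_sup. split; [now exists (S n)|].
    intros z. simpl. destruct (num n) as [A f]. rewrite !amem_sup. split.
    * intros [[a|] ->]; [left; now exists a | now right].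
    * intros [[a ->] | ->]; [now exists (Some a) | now exists None].
- intros R s HR. destruct (is_sup s) as [A [f ->]].
  exists (cl (sup (fun p : {a | exists v, R (cl (f a)) v} =>
    rep (proj1_sig (constructive_indefinite_description _ (proj2_sig p)))))).
  intros v. rewrite amem_sup. split.
  + intros [[a Ha] ->]. rewrite cl_rep. exists (cl (f a)).
    rewrite amem_sup. split; [now exists a|]. apply proj2_sig.
  + intros [u [Hu Huv]]. assert (Hu' := Hu). apply amem_sup in Hu'.
    destruct Hu' as [a ->]. exists (exist _ a (ex_intro _ v Huv)).
    rewrite cl_rep. simpl. eapply HR; [exact Hu | exact Huv | apply proj2_sig].
- intros s Hne Hdis. destruct (is_sup s) as [A [f ->]].
  pose (pick := fun t : aset => epsilon (inhabits t) (fun z => amem z t)).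
  assert (Hpick : forall a, amem (pick (cl (f a))) (cl (f a))).
  { intros a. unfold pick. apply epsilon_spec. apply Hne. apply amem_sup.
    now exists a. }
  exists (cl (sup (fun a => rep (pick (cl (f a)))))).
  intros y Hy. assert (Hy' := Hy). apply amem_sup in Hy'. destruct Hy' as [a ->].
  exists (pick (cl (f a))). split.
  + split; [apply Hpick|]. apply amem_sup. exists a. now rewrite cl_rep.
  + intros z [Hz Hz']. apply amem_sup in Hz'. destruct Hz' as [b Hb].
    rewrite cl_rep in Hb. subst z. f_equal.
    eapply Hdis; [exact Hy | | exact Hz | apply Hpick].
    apply amem_sup. now exists b.
Qed.

End AczelModel.

Section SetTheory.
Context {V : ZFC}.
Implicit Types (x y z v alpha beta gamma delta theta kappa mu nu xi zeta U X Y : V).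

Definition transitive x : Prop := forall y z, z ∈ y -> y ∈ x -> z ∈ x.

Definition ordinal x : Prop := transitive x /\ forall y, y ∈ x -> transitive y.

Definition ord_le alpha beta : Prop := alpha = beta \/ alpha ∈ beta.

Definition limit_ordinal alpha : Prop :=
  ordinal alpha /\ (exists beta, beta ∈ alpha) /\
  forall beta, beta ∈ alpha -> exists gamma, gamma ∈ alpha /\ beta ∈ gamma.

Definition is_omega alpha : Prop :=
  limit_ordinal alpha /\ forall beta, beta ∈ alpha -> ~ limit_ordinal beta.

Definition bijection (f : V -> V) x y : Prop :=
  (forall z, z ∈ x -> f z ∈ y) /\
  (forall z z', z ∈ x -> z' ∈ x -> f z = f z' -> z = z') /\
  (forall v, v ∈ y -> exists z, z ∈ x /\ f z = v).

Definition cardinal kappa : Prop :=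
  ordinal kappa /\
  forall beta, beta ∈ kappa -> ~ exists f, bijection f beta kappa.

Definition uncountable kappa : Prop := exists w, is_omega w /\ w ∈ kappa.

Definition regular kappa : Prop :=
  cardinal kappa /\ limit_ordinal kappa /\
  forall beta (f : V -> V), beta ∈ kappa ->
    (forall delta, delta ∈ beta -> f delta ∈ kappa) ->
    exists gamma, gamma ∈ kappa /\ forall delta, delta ∈ beta -> f delta ∈ gamma.

Definition cardinal_successor kappa mu : Prop :=
  cardinal mu /\ kappa ∈ mu /\
  forall nu, cardinal nu -> kappa ∈ nu -> ord_le mu nu.

(** [xi < kappa^+] *)
Definition below_successor kappa xi : Prop :=
  exists mu, cardinal_successor kappa mu /\ xi ∈ mu.

(** [x] belongs to [V_alpha], where [V_alpha] is the union of the power sets of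
    the [V_beta] for [beta < alpha]. *)
Inductive in_V : V -> V -> Prop :=
| in_V_intro alpha beta x :
    beta ∈ alpha -> (forall y, y ∈ x -> in_V beta y) -> in_V alpha x.

(** The set of all [x] in [kappa] such that [P x] belongs to [U]. *)
Definition sep_in kappa (P : V -> Prop) U : Prop :=
  exists X, X ∈ U /\ forall x, x ∈ X <-> x ∈ kappa /\ P x.

Definition ultrafilter kappa U : Prop :=
  (forall X x, X ∈ U -> x ∈ X -> x ∈ kappa) /\
  kappa ∈ U /\
  (forall X, X ∈ U -> exists x, x ∈ X) /\
  (forall X Y, X ∈ U -> Y ∈ U -> sep_in kappa (fun x => x ∈ X /\ x ∈ Y) U) /\
  (forall X Y, X ∈ U -> (forall x, x ∈ X -> x ∈ Y) ->
     (forall y, y ∈ Y -> y ∈ kappa) -> Y ∈ U) /\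
  (forall X, (forall x, x ∈ X -> x ∈ kappa) ->
     X ∈ U \/ sep_in kappa (fun x => ~ x ∈ X) U).

Definition nonprincipal kappa U : Prop :=
  forall alpha, alpha ∈ kappa -> ~ sep_in kappa (fun x => x = alpha) U.

Definition complete kappa U : Prop :=
  forall beta (A : V -> V), beta ∈ kappa ->
    (forall delta, delta ∈ beta -> A delta ∈ U) ->
    sep_in kappa (fun x => forall delta, delta ∈ beta -> x ∈ A delta) U.

Definition normal kappa U : Prop :=
  forall A : V -> V, (forall delta, delta ∈ kappa -> A delta ∈ U) ->
    sep_in kappa (fun x => forall delta, delta ∈ x -> x ∈ A delta) U.

Definition measure kappa U : Prop :=
  ultrafilter kappa U /\ nonprincipal kappa U /\ complete kappa U.

Definition measurable kappa : Prop :=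
  cardinal kappa /\ uncountable kappa /\ exists U, measure kappa U.

Definition normal_measure kappa U : Prop := measure kappa U /\ normal kappa U.

Definition bijection_choice (b : V -> V -> V -> V) : Prop :=
  forall kappa, regular kappa ->
    (forall xi, ord_le kappa xi -> below_successor kappa xi ->
       bijection (b kappa xi) kappa xi) /\
    (forall alpha, alpha ∈ kappa -> b kappa kappa alpha = alpha).

(** [F b kappa xi alpha] is the set F^kappa_xi(alpha). *)
Definition F (b : V -> V -> V -> V) kappa xi alpha : V -> Prop := fun z =>
  (xi ∈ kappa /\ z ∈ xi) \/
  (ord_le kappa xi /\ exists beta, beta ∈ alpha /\ z = b kappa xi beta).

Definition order_type (X : V -> Prop) theta : Prop :=
  ordinal theta /\
  exists g : V -> V,
    (forall z, X z -> g z ∈ theta) /\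
    (forall zeta, zeta ∈ theta -> exists z, X z /\ g z = zeta) /\
    (forall z z', X z -> X z' -> (z ∈ z' <-> g z ∈ g z')).

(** [p z] is the set of all [p w] with [w] in [X] and [w ∈ z]. *)
Definition transitive_collapse (X : V -> Prop) (p : V -> V) : Prop :=
  forall z, X z -> forall v, v ∈ p z <-> exists w, X w /\ w ∈ z /\ v = p w.

End SetTheory.

(** [Mem i j] and [Eq i j] are the atoms on the variables [x_i] and [x_j];
    [Ex gamma a psi] quantifies the variables [x_(a eta)] for [eta < gamma]. *)
Inductive form (V : ZFC) : Type :=
| Mem (i j : V)
| Eq (i j : V)
| Neg (psi : form V)
| Conj (xi : V) (phi : el xi -> form V)
| Ex (gamma : V) (a : el gamma -> V) (psi : form V).

Arguments Mem {V} i j.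
Arguments Eq {V} i j.
Arguments Neg {V} psi.
Arguments Conj {V} xi phi.
Arguments Ex {V} gamma a psi.

Section Logic.
Context {V : ZFC}.
Implicit Types (v alpha gamma kappa xi theta : V) (phi psi chi : form V).

(** [phi] is a formula of L_{kappa^+,kappa^+}. *)
Fixpoint in_L kappa phi : Prop :=
  match phi with
  | Mem i j => i ∈ kappa /\ j ∈ kappa
  | Eq i j => i ∈ kappa /\ j ∈ kappa
  | Neg psi => in_L kappa psi
  | Conj xi phi => below_successor kappa xi /\ forall zeta, in_L kappa (phi zeta)
  | Ex gamma a psi =>
      ord_le gamma kappa /\
      (forall eta, a eta ∈ kappa) /\
      (forall eta eta' : el gamma, val eta ∈ val eta' -> a eta ∈ a eta') /\
      in_L kappa psi
  end.

Fixpoint free v phi : Prop :=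
  match phi with
  | Mem i j => v = i \/ v = j
  | Eq i j => v = i \/ v = j
  | Neg psi => free v psi
  | Conj _ phi => exists zeta, free v (phi zeta)
  | Ex _ a psi => free v psi /\ ~ exists eta, v = a eta
  end.

Definition sentence phi : Prop := forall v, ~ free v phi.

(** Satisfaction in the structure (V_alpha, ∈) under the assignment [s]. *)
Fixpoint sat alpha phi (s : V -> V) : Prop :=
  match phi with
  | Mem i j => s i ∈ s j
  | Eq i j => s i = s j
  | Neg psi => ~ sat alpha psi s
  | Conj _ phi => forall zeta, sat alpha (phi zeta) s
  | Ex _ a psi =>
      exists t : V -> V,
        (forall eta, in_V alpha (t (a eta))) /\
        (forall v, (~ exists eta, v = a eta) -> t v = s v) /\
        sat alpha psi t
  end.

(** Only meant for sentences, whose truth does not depend on [s]; values of [s]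
    are not required to be in V_alpha because V_0 is empty. *)
Definition models alpha phi : Prop := forall s, sat alpha phi s.

(** [restriction b kappa alpha phi chi]: the restriction of [phi] to [alpha]
    with respect to [kappa] is defined and equal to [chi]. *)
Fixpoint restriction (b : V -> V -> V -> V) kappa alpha phi chi : Prop :=
  match phi with
  | Mem i j => chi = Mem i j
  | Eq i j => chi = Eq i j
  | Neg psi => exists psi', restriction b kappa alpha psi psi' /\ chi = Neg psi'
  | Conj xi phi =>
      exists theta (phi' : el theta -> form V) (p : V -> V),
        order_type (F b kappa xi alpha) theta /\
        transitive_collapse (F b kappa xi alpha) p /\
        (forall (z : el xi) (zeta : el theta),
           F b kappa xi alpha z -> p z = zeta ->
           restriction b kappa alpha (phi z) (phi' zeta)) /\
        chi = Conj theta phi' /\ in_L alpha chi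
  | Ex gamma a psi =>
      exists gamma' (a' : el gamma' -> V) psi',
        (forall eta, eta ∈ gamma' <-> eta ∈ alpha /\ eta ∈ gamma) /\
        (forall (eta : el gamma) (eta' : el gamma'),
           val eta = val eta' -> a' eta' = a eta) /\
        restriction b kappa alpha psi psi' /\
        chi = Ex gamma' a' psi' /\ in_L alpha chi
  end.

Definition indescribable (b : V -> V -> V -> V) kappa : Prop :=
  regular kappa /\
  forall phi, in_L kappa phi -> sentence phi -> models kappa phi ->
    exists alpha, alpha ∈ kappa /\ cardinal alpha /\
      exists chi, restriction b kappa alpha phi chi /\ models alpha chi.

End Logic.

(* Main.v *)
(** The ultrapower argument, without the ultrapower.  A normal measure gives a
    quantifier "for almost all" that commutes with negation and with diagonal
    intersections; truth at [kappa] is another such quantifier.  Let W be the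
    measure quantifier and Q either of the two.  By induction on families of
    formulas [phi i] of L_{i^+,i^+}, for W-almost all [beta] and Q-almost all [i],
    the restriction of [phi i] to [beta] is defined, and it holds in V_beta iff
    [phi i] holds in V_i.  Conjunctions use normality; for existential
    quantifiers, the coordinates of witnesses are regressive in [beta], hence
    almost everywhere constant.  Taking for Q truth at [kappa] makes [kappa]
    indescribable; taking Q = W refutes a family of counterexamples [phi i]. *)

From Stdlib Require Import Classical ClassicalEpsilon FunctionalExtensionality.
Require Import Defs.

Set Implicit Arguments.
Unset Strict Implicit.

(** Behind the argument is the identity that restricting j(phi) to kappa returns phi up to
    reindexing, where j is the ultrapower embedding; [beta] stands for kappa and [i] for j(kappa).
    Restriction to [beta] keeps exactly what has index below [beta]. Any datum attached to [i] that
    is regressive (a variable, the index of a failing conjunct, a bound on the rank of a set) is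
    constant for Q-almost all [i], hence lies below W-almost all [beta] and survives. The
    exceptional sets, one for each index below [beta], are absorbed by a diagonal intersection for W
    and by completeness for Q. Families are forced because a conjunct may be chosen differently at
    each [i], so that an induction on each [phi i] separately would not keep the exceptional sets
    under control. The delicate direction is the existential one: a witness found in V_beta depends
    on both [beta] and [i], and a single witness in V_i must be extracted from all of them. *)

Lemma total_choice (A B : Type) (R : A -> B -> Prop) :
  inhabited B -> exists f : A -> B, forall a, (exists b, R a b) -> R a (f a).
Proof.
  intros inhB. exists (fun a => epsilon inhB (R a)).
  intros a H. now apply epsilon_spec.
Qed.

(** * Sets and ordinals *)

Section Sets.
Context {V : ZFC}.
Implicit Types (x y z v alpha beta gamma kappa theta : V).

Lemma V_inhabited : inhabited V.
Proof. destruct (infinity V) as [w _]. exact (inhabits w). Qed.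

Lemma mem_irrefl x : ~ x ∈ x.
Proof. induction (foundation x) as [x _ IH]. intros H. exact (IH x H H). Qed.

Lemma mem_asym x : forall y, x ∈ y -> ~ y ∈ x.
Proof.
  induction (foundation x) as [x _ IH]. intros y H H'. exact (IH y H' x H' H).
Qed.

Lemma separation x (P : V -> Prop) : exists y, forall z, z ∈ y <-> z ∈ x /\ P z.
Proof.
  destruct (@replacement V (fun u v => v = u /\ P u) x) as [y Hy].
  { intros u v v' _ [-> _] [-> _]. reflexivity. }
  exists y. intros z. rewrite Hy. split.
  - now intros (u & Hu & -> & HP).
  - intros [Hz HP]. now exists z.
Qed.

Lemma image_set x (f : V -> V) :
  exists y, forall v, v ∈ y <-> exists u, u ∈ x /\ v = f u.
Proof.
  apply (@replacement V (fun u v => v = f u)).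
  intros u v v' _ -> ->. reflexivity.
Qed.

Lemma el_eq x (z z' : el x) : val z = val z' -> z = z'.
Proof.
  destruct z as [z H], z' as [z' H']. simpl. intros <-. f_equal.
  apply proof_irrelevance.
Qed.

(** Trades functions on the subtype [el x] for total ones, so that the parts of formulas at varying
    [i] form families without dependent types. *)
Lemma total_extension (A : Type) x (a : el x -> A) :
  inhabited A -> exists a' : V -> A, a = fun z : el x => a' (val z).
Proof.
  intros inhA.
  destruct (total_choice (fun v c => exists z : el x, val z = v /\ a z = c) inhA)
    as [a' Ha'].
  exists a'. apply functional_extensionality. intros z.
  destruct (Ha' (val z)) as (z' & E & <-).
  { now exists (a z), z. }
  f_equal. symmetry. now apply el_eq.
Qed.

Lemma ordinal_el x y : ordinal x -> y ∈ x -> ordinal y.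
Proof.
  intros [Hx Hx'] Hy. split; [now apply Hx'|].
  intros z Hz. apply Hx'. now apply (Hx y z).
Qed.

Lemma ordinal_trans x y z : ordinal x -> z ∈ y -> y ∈ x -> z ∈ x.
Proof. intros [Hx _]. apply Hx. Qed.

Lemma ordinal_total x : forall y,
  ordinal x -> ordinal y -> x ∈ y \/ x = y \/ y ∈ x.
Proof.
  induction (foundation x) as [x _ IHx]. intros y.
  induction (foundation y) as [y _ IHy]. intros Ox Oy.
  destruct (classic (x ∈ y)) as [|Nxy]; [now left|].
  destruct (classic (y ∈ x)) as [|Nyx]; [now right; right|].
  right; left. apply extensionality. intros z. split; intros Hz.
  - destruct (IHx z Hz y (ordinal_el Ox Hz) Oy) as [H | [-> | H]]; [easy|easy|].
    destruct Nyx. exact (ordinal_trans Ox H Hz).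
  - destruct (IHy z Hz Ox (ordinal_el Oy Hz)) as [H | [-> | H]]; [|easy|easy].
    destruct Nxy. exact (ordinal_trans Oy H Hz).
Qed.

Lemma subset_ord_le x y :
  ordinal x -> ordinal y -> (forall z, z ∈ x -> z ∈ y) -> ord_le x y.
Proof.
  intros Ox Oy H. destruct (ordinal_total Ox Oy) as [|[|Hyx]].
  - now right.
  - now left.
  - destruct (mem_irrefl (H y Hyx)).
Qed.

Lemma in_V_mono alpha beta x :
  ordinal beta -> alpha ∈ beta -> in_V alpha x -> in_V beta x.
Proof.
  intros Ob Hab H. inversion H as [alpha' g x' Hg Hx]; subst.
  apply in_V_intro with g; [|exact Hx]. exact (ordinal_trans Ob Hg Hab).
Qed.

Lemma in_V_set alpha : exists v, forall x, x ∈ v <-> in_V alpha x.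
Proof.
  induction (foundation alpha) as [alpha _ IH].
  destruct (@replacement V (fun b p =>
    forall x, x ∈ p <-> forall y, y ∈ x -> in_V b y) alpha) as [Y HY].
  { intros u v v' _ H H'. apply extensionality. intros z.
    now rewrite H, H'. }
  destruct (union Y) as [v Hv]. exists v. intros x. rewrite Hv. split.
  - intros (p & Hp & Hx). apply HY in Hp. destruct Hp as (b & Hb & Hp).
    apply in_V_intro with b; [exact Hb|]. now apply Hp.
  - intros H. inversion H as [alpha' b x' Hb Hx]; subst.
    destruct (IH b Hb) as [vb Hvb]. destruct (powerset vb) as [p Hp].
    assert (Hp' : forall x, x ∈ p <-> forall y, y ∈ x -> in_V b y).
    { intros u. rewrite Hp. split; intros Hu y Hy; apply Hvb, Hu, Hy. }
    exists p. split; [|now apply Hp'].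
    apply HY. now exists b.
Qed.

Lemma in_V_empty alpha x beta :
  beta ∈ alpha -> (forall z, ~ z ∈ x) -> in_V alpha x.
Proof.
  intros Hb Hx. apply in_V_intro with beta; [exact Hb|].
  intros y Hy. destruct (Hx y Hy).
Qed.

(** Recursion on membership; replacement supplies the set of earlier values that [step] selects. The
    equation is obtained at every [z], inside [X] or not. *)
Lemma collapse_exists (X : V -> Prop) :
  exists p : V -> V, forall z v, v ∈ p z <-> exists w, X w /\ w ∈ z /\ v = p w.
Proof.
  pose (step := fun z (rec : forall w, w ∈ z -> V) =>
    epsilon V_inhabited (fun y =>
      forall v, v ∈ y <-> exists w (h : w ∈ z), X w /\ v = rec w h)).
  pose (p := Fix (@foundation V) (fun _ => carrier V) step).
  assert (Ep : forall z, p z = step z (fun w _ => p w)).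
  { intros z. unfold p.
    refine (Fix_eq (@foundation V) (fun _ => carrier V) step _ z).
    intros y f g Hfg. f_equal.
    apply functional_extensionality_dep. intros w.
    apply functional_extensionality. intros h. apply Hfg. }
  exists p. intros z v. rewrite Ep. unfold step.
  assert (E : exists y, forall v,
    v ∈ y <-> exists w (h : w ∈ z), X w /\ v = p w).
  { destruct (separation z X) as [y Hy].
    destruct (image_set y p) as [y' Hy'].
    exists y'. intros u. rewrite Hy'. split.
    - intros (w & Hw & ->). apply Hy in Hw. destruct Hw as [h Hw].
      now exists w, h.
    - intros (w & h & Hw & ->). exists w. split; [now apply Hy|easy]. }
  apply (epsilon_spec V_inhabited) in E. rewrite E. split.
  - intros (w & h & Hw & ->). now exists w.
  - intros (w & Hw & h & ->). now exists w, h.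
Qed.

Lemma collapse_mono (X : V -> Prop) p (z z' : V) :
  (forall z, X z -> ordinal z) -> transitive_collapse X p -> X z -> X z' ->
  (z ∈ z' <-> p z ∈ p z').
Proof.
  intros OX Hp Hz Hz'.
  assert (Hmono : forall u u', X u -> X u' -> u ∈ u' -> p u ∈ p u').
  { intros u u' Hu Hu' H. apply Hp; [exact Hu'|]. now exists u. }
  split; [now apply Hmono|].
  intros H. destruct (ordinal_total (OX z Hz) (OX z' Hz')) as [|[->|H']].
  - assumption.
  - destruct (mem_irrefl H).
  - destruct (mem_asym H (Hmono _ _ Hz' Hz H')).
Qed.

Lemma collapse_inj (X : V -> Prop) p (z z' : V) :
  (forall z, X z -> ordinal z) -> transitive_collapse X p -> X z -> X z' ->
  p z = p z' -> z = z'.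
Proof.
  intros OX Hp Hz Hz' E.
  destruct (ordinal_total (OX z Hz) (OX z' Hz')) as [H|[H|H]]; [|exact H|];
    apply (collapse_mono OX Hp) in H; auto; rewrite E in H;
    destruct (mem_irrefl H).
Qed.

Lemma collapse_order_type (X : V -> Prop) p x :
  (forall z, X z -> ordinal z) -> (forall z, X z -> z ∈ x) ->
  transitive_collapse X p ->
  exists theta, order_type X theta /\
    forall v, v ∈ theta <-> exists z, X z /\ v = p z.
Proof.
  intros OX Xx Hp. destruct (separation x X) as [y Hy].
  destruct (image_set y p) as [theta Ht].
  assert (Ht' : forall v, v ∈ theta <-> exists z, X z /\ v = p z).
  { intros v. rewrite Ht. split; intros (z & Hz & ->); exists z.
    - now apply Hy in Hz.
    - split; [|easy]. apply Hy. auto. }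
  exists theta. split; [|exact Ht']. split.
  - split.
    + intros v u Hu Hv. apply Ht' in Hv. destruct Hv as (z & Hz & ->).
      apply Hp in Hu; [|exact Hz]. destruct Hu as (w & Hw & _ & ->).
      apply Ht'. now exists w.
    + intros v Hv. apply Ht' in Hv. destruct Hv as (z & Hz & ->).
      intros u t Htu Hu.
      apply Hp in Hu; [|exact Hz]. destruct Hu as (w & Hw & Hwz & ->).
      apply Hp in Htu; [|exact Hw]. destruct Htu as (w' & Hw' & Hww & ->).
      apply Hp; [exact Hz|]. exists w'. repeat split; auto.
      exact (ordinal_trans (OX z Hz) Hww Hwz).
  - exists p. repeat split.
    + intros z Hz. apply Ht'. now exists z.
    + intros zeta Hz. apply Ht' in Hz. destruct Hz as (z & Hz & ->).
      now exists z.
    + now apply collapse_mono with X.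
    + now apply collapse_mono with X.
Qed.

(** [restriction] gives the order type and the collapse independently. By membership induction the
    collapse agrees on [X] with any isomorphism onto an ordinal, so both have the same range. *)
Lemma collapse_onto (X : V -> Prop) p theta :
  order_type X theta -> transitive_collapse X p ->
  (forall z, X z -> p z ∈ theta) /\
  (forall zeta, zeta ∈ theta -> exists z, X z /\ p z = zeta).
Proof.
  intros (Ot & g & Hg & Hg' & Hgm) Hp.
  assert (E : forall z, X z -> p z = g z).
  { intros z. induction (foundation z) as [z _ IH]. intros Hz.
    apply extensionality. intros v. rewrite (Hp z Hz). split.
    - intros (w & Hw & Hwz & ->). rewrite (IH w Hwz Hw). now apply (Hgm w z Hw Hz).
    - intros Hv. destruct (Hg' v) as (w & Hw & <-).
      { exact (ordinal_trans Ot Hv (Hg z Hz)). }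
      assert (Hwz : w ∈ z) by now apply (Hgm w z Hw Hz).
      exists w. repeat split; auto. symmetry. now apply IH. }
  split.
  - intros z Hz. rewrite E by exact Hz. auto.
  - intros zeta Hz. destruct (Hg' zeta Hz) as (z & HX & <-).
    exists z. auto.
Qed.

(** [cardinal] only excludes bijections. A section [g] of the surjection has its range [X] inside
    [beta]; collapsing [X] gives an ordinal [theta] at most [beta] in bijection with [mu]. *)
Lemma no_surjection_cardinal beta mu (f : V -> V) :
  cardinal mu -> beta ∈ mu ->
  ~ forall v, v ∈ mu -> exists delta, delta ∈ beta /\ f delta = v.
Proof.
  intros [Om Cm] Hb Hf.
  assert (Ob := ordinal_el Om Hb).
  destruct (total_choice (fun v d => d ∈ beta /\ f d = v) V_inhabited)
    as [g Hg].
  assert (Hg' : forall v, v ∈ mu -> g v ∈ beta /\ f (g v) = v) by auto.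
  pose (X := fun d => exists v, v ∈ mu /\ g v = d).
  assert (Xb : forall d, X d -> d ∈ beta).
  { intros d (v & Hv & <-). now apply Hg'. }
  assert (OX : forall d, X d -> ordinal d).
  { intros d Hd. exact (ordinal_el Ob (Xb d Hd)). }
  destruct (collapse_exists X) as [p Hp].
  assert (Hp' : transitive_collapse X p) by (intros z _; apply Hp).
  destruct (collapse_order_type OX Xb Hp') as (theta & (Ot & _) & Ht).
  (* A collapse never raises an ordinal; hence [theta] is contained in [beta]. *)
  assert (Hpz : forall z, ordinal z -> ord_le (p z) z).
  { intros z. induction (foundation z) as [z _ IH]. intros Oz.
    destruct (classic (ord_le (p z) z)) as [|N]; [assumption|].
    assert (Op : forall z, X z -> p z ∈ theta) by (intros u Hu; apply Ht; eauto).
    apply subset_ord_le; [|exact Oz|].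
    - split.
      + intros v u Hu Hv. apply Hp in Hv. destruct Hv as (w & Hw & Hwz & ->).
        apply Hp in Hu. destruct Hu as (w' & Hw' & Hww & ->).
        apply Hp. exists w'. repeat split; auto.
        exact (ordinal_trans Oz Hww Hwz).
      + intros v Hv. apply Hp in Hv. destruct Hv as (w & Hw & Hwz & ->).
        exact (proj1 (ordinal_el Ot (Op w Hw))).
    - intros v Hv. apply Hp in Hv. destruct Hv as (w & Hw & Hwz & ->).
      destruct (IH w Hwz (ordinal_el Oz Hwz)) as [-> | H]; [exact Hwz|].
      exact (ordinal_trans Oz H Hwz). }
  assert (Htb : forall v, v ∈ theta -> v ∈ beta).
  { intros v Hv. apply Ht in Hv. destruct Hv as (z & Hz & ->).
    destruct (Hpz z (OX z Hz)) as [-> | H]; [auto|].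
    exact (ordinal_trans Ob H (Xb z Hz)). }
  assert (Htm : theta ∈ mu).
  { destruct (subset_ord_le Ot Ob Htb) as [-> | H]; [exact Hb|].
    exact (ordinal_trans Om H Hb). }
  assert (Xg : forall v, v ∈ mu -> X (g v)) by (intros v Hv; now exists v).
  apply (Cm theta Htm).
  destruct (total_choice (fun v u => u ∈ mu /\ p (g u) = v) V_inhabited)
    as [h Hh].
  assert (Hh' : forall v, v ∈ theta -> h v ∈ mu /\ p (g (h v)) = v).
  { intros v Hv. apply Hh. apply Ht in Hv.
    destruct Hv as (z & (u & Hu & <-) & ->). now exists u. }
  exists h. repeat split.
  - intros v Hv. now apply Hh'.
  - intros v v' Hv Hv' E. destruct (Hh' v Hv) as [_ <-], (Hh' v' Hv') as [_ <-].
    now rewrite E.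
  - intros u Hu. exists (p (g u)).
    assert (Hu' : p (g u) ∈ theta) by (apply Ht; exists (g u); auto).
    split; [exact Hu'|].
    destruct (Hh' _ Hu') as [H1 H2]. apply (collapse_inj OX Hp') in H2; auto.
    rewrite <- (proj2 (Hg' _ H1)), H2. now apply Hg'.
Qed.

(** Descends from a given larger cardinal to the least one. In the application [mu] is the regular
    cardinal to which the formula belongs. *)
Lemma cardinal_successor_exists beta mu :
  cardinal mu -> beta ∈ mu -> exists nu, cardinal_successor beta nu.
Proof.
  induction (foundation mu) as [mu _ IH]. intros Cm Hb.
  destruct (classic (exists nu, nu ∈ mu /\ cardinal nu /\ beta ∈ nu))
    as [(nu & Hn & Cn & Hbn) | N].
  - exact (IH nu Hn Cn Hbn).
  - exists mu. split; [exact Cm|]. split; [exact Hb|].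
    intros nu Cn Hbn. destruct (ordinal_total (proj1 Cm) (proj1 Cn)) as [H|[H|H]].
    + now right.
    + now left.
    + destruct N. now exists nu.
Qed.

Lemma below_successor_surjection beta mu theta (f : V -> V) :
  cardinal mu -> beta ∈ mu -> ordinal theta ->
  (forall v, v ∈ theta -> exists delta, delta ∈ beta /\ f delta = v) ->
  below_successor beta theta.
Proof.
  intros Cm Hb Ot Hf.
  destruct (cardinal_successor_exists Cm Hb) as (nu & Hn).
  exists nu. split; [exact Hn|]. destruct Hn as (Cn & Hbn & _).
  destruct (ordinal_total Ot (proj1 Cn)) as [H|H]; [exact H|exfalso].
  apply (no_surjection_cardinal (f := f) Cn Hbn). intros v Hv. apply Hf.
  destruct H as [-> | H]; [exact Hv|]. exact (ordinal_trans Ot Hv H).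
Qed.

Lemma below_successor_ordinal kappa xi : below_successor kappa xi -> ordinal xi.
Proof. intros (mu & ((Om & _) & _) & H). exact (ordinal_el Om H). Qed.

Lemma increasing_ge gamma (a : V -> V) : ordinal gamma ->
  (forall eta, eta ∈ gamma -> ordinal (a eta)) ->
  (forall eta eta', eta ∈ gamma -> eta' ∈ gamma -> eta ∈ eta' -> a eta ∈ a eta') ->
  forall eta, eta ∈ gamma -> ord_le eta (a eta).
Proof.
  intros Og Oa Ha eta. induction (foundation eta) as [eta _ IH]. intros He.
  destruct (ordinal_total (ordinal_el Og He) (Oa eta He)) as [H|[H|H]].
  - now right.
  - now left.
  - assert (H' := ordinal_trans Og H He). assert (H2 := Ha _ _ H' He H).
    destruct (IH _ H H') as [E | H3].
    + rewrite <- E in H2. destruct (mem_irrefl H2).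
    + destruct (mem_asym H2 H3).
Qed.

Lemma limit_regular_cardinal i : limit_ordinal i ->
  (forall beta (f : V -> V), beta ∈ i ->
    (forall delta, delta ∈ beta -> f delta ∈ i) ->
    exists gamma, gamma ∈ i /\ forall delta, delta ∈ beta -> f delta ∈ gamma) ->
  regular i.
Proof.
  intros Li Hi. split; [split|]; [apply Li| |now split].
  intros beta Hb (f & Hf & _ & Hsurj).
  destruct (Hi beta f Hb Hf) as (gamma & Hg & H).
  destruct (Hsurj gamma Hg) as (d & Hd & E).
  specialize (H d Hd). rewrite E in H. exact (mem_irrefl H).
Qed.

End Sets.

(** * Normal quantifiers *)

(** An ultrafilter written as a quantifier over all of [V]: the index [kappa], at which one of the
    two instances evaluates, is not a member of [kappa]. *)
Record normal_quantifier {V : ZFC} (kappa : V) (Q : (V -> Prop) -> Prop) : Prop := {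
  nq_mono : forall P R : V -> Prop, Q P -> (forall i, P i -> R i) -> Q R;
  nq_and : forall P R : V -> Prop, Q P -> Q R -> Q (fun i => P i /\ R i);
  nq_ultra : forall P : V -> Prop, Q P \/ Q (fun i => ~ P i);
  nq_witness : forall P : V -> Prop, Q P -> exists i, P i;
  nq_diagonal : forall P : V -> V -> Prop,
    (forall delta, delta ∈ kappa -> Q (P delta)) ->
    Q (fun i => forall delta, delta ∈ i -> P delta i);
  nq_large : forall delta, delta ∈ kappa -> Q (fun i => delta ∈ i);
  nq_ordinal : Q ordinal
}.

Definition sub_form {V : ZFC} (psi phi : form V) : Prop :=
  match phi with
  | Neg phi' => psi = phi'
  | Conj _ f => exists z, psi = f z
  | Ex _ _ phi' => psi = phi'
  | _ => False
  end.

Lemma sub_form_wf (V : ZFC) : well_founded (@sub_form V).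
Proof.
  intros phi. induction phi as [i j|i j|phi IH|xi f IH|gamma a phi IH];
    constructor; intros psi H; simpl in H.
  - destruct H.
  - destruct H.
  - now subst psi.
  - destruct H as [z ->]. apply IH.
  - now subst psi.
Qed.

Section Quantifier.
Context {V : ZFC} (kappa : V) (Q : (V -> Prop) -> Prop).
Hypothesis HQ : normal_quantifier kappa Q.

Lemma nq_all (R : V -> Prop) : (forall i, R i) -> Q R.
Proof.
  intros H. destruct (nq_ultra HQ R) as [|N]; [assumption|].
  apply (nq_mono HQ N). auto.
Qed.

Lemma nq_imp (P R : V -> Prop) : Q P -> Q (fun i => P i -> R i) -> Q R.
Proof.
  intros H H'. apply (nq_mono HQ (nq_and HQ H H')). now intros i [HP HR]; auto.
Qed.

Lemma nq_not (P : V -> Prop) : ~ Q P -> Q (fun i => ~ P i).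
Proof. intros N. now destruct (nq_ultra HQ P). Qed.

Lemma nq_or (P R : V -> Prop) : Q (fun i => P i \/ R i) -> Q P \/ Q R.
Proof.
  intros H. destruct (nq_ultra HQ P) as [|N]; [now left|right].
  apply (nq_imp H), (nq_imp N), nq_all. tauto.
Qed.

Lemma nq_choice (B : Type) (R : V -> B -> Prop) :
  Q (fun i => exists x, R i x) -> exists f : V -> B, Q (fun i => R i (f i)).
Proof.
  intros H. destruct (nq_witness HQ H) as (_ & b & _).
  destruct (total_choice R (inhabits b)) as [f Hf].
  exists f. exact (nq_mono HQ H Hf).
Qed.

(** A diagonal intersection with trivial conditions outside [beta]; almost every [i] includes
    [beta]. *)
Lemma nq_complete beta (P : V -> V -> Prop) : beta ∈ kappa ->
  (forall delta, delta ∈ beta -> Q (P delta)) ->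
  Q (fun i => forall delta, delta ∈ beta -> P delta i).
Proof.
  intros Hb H.
  assert (D : Q (fun i => forall delta, delta ∈ i -> delta ∈ beta -> P delta i)).
  { apply (nq_diagonal HQ (P := fun delta i => delta ∈ beta -> P delta i)).
    intros delta _. destruct (classic (delta ∈ beta)) as [Hd|N].
    - apply (nq_mono HQ (H delta Hd)). auto.
    - apply nq_all. now intros i Hd. }
  apply (nq_imp D), (nq_imp (nq_large HQ Hb)), (nq_imp (nq_ordinal HQ)), nq_all.
  intros i Oi Hbi Hi delta Hd. apply Hi; [|exact Hd].
  exact (ordinal_trans Oi Hd Hbi).
Qed.

(** Fodor's lemma for an ultrafilter: if [f] avoided each value almost everywhere, diagonalising
    would give an [i] at which [f i] differs from itself. *)
Lemma nq_regressive (f : V -> V) : Q (fun i => f i ∈ i) ->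
  exists gamma, gamma ∈ kappa /\ Q (fun i => f i = gamma).
Proof.
  intros H. apply NNPP. intros N.
  assert (D : Q (fun i => forall delta, delta ∈ i -> f i <> delta)).
  { apply (nq_diagonal HQ (P := fun delta i => f i <> delta)).
    intros delta Hd. apply nq_not. intros E. apply N. now exists delta. }
  destruct (nq_witness HQ (nq_and HQ H D)) as (i & Hi & Hi').
  now apply (Hi' (f i)).
Qed.

(** The ultrapower adds no new subsets of V_beta for [beta] below [kappa]. The limit [c] collects
    what belongs to almost every [x i]. A disagreement [y i] between [x i] and [c] has rank below
    [beta], so by pressing down and induction it is almost always one set [d], whose membership in
    [c] is decided correctly by definition. *)
Lemma nq_in_V_bounded beta : beta ∈ kappa -> forall x : V -> V,
  Q (fun i => forall y, y ∈ x i -> in_V beta y) ->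
  exists c, (forall y, y ∈ c -> in_V beta y) /\ Q (fun i => x i = c).
Proof.
  induction (foundation beta) as [beta _ IH]. intros Hb x Hx.
  destruct (in_V_set beta) as [v Hv].
  destruct (separation v (fun y => Q (fun i => y ∈ x i))) as [c Hc].
  assert (cV : forall y, y ∈ c -> in_V beta y).
  { intros y Hy. apply Hv. now apply Hc. }
  exists c. split; [exact cV|].
  apply NNPP. intros N. apply nq_not in N.
  destruct (nq_choice (R := fun i y => in_V beta y /\ ~ (y ∈ x i <-> y ∈ c)))
    as [y Hy].
  { apply (nq_imp Hx), (nq_imp N), nq_all. intros i Ni Hxi.
    apply NNPP. intros Hne. apply Ni, extensionality. intros y.
    apply NNPP. intros Hy. apply Hne. exists y. split; [|exact Hy].
    destruct (classic (y ∈ x i)); [now apply Hxi|].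
    apply cV. tauto. }
  destruct (nq_choice (R := fun i g =>
    g ∈ beta /\ forall u, u ∈ y i -> in_V g u)) as [g Hg].
  { apply (nq_imp Hy), nq_all. intros i [H _]. inversion H as [b' g y' Hg Hu].
    now exists g. }
  destruct (nq_regressive (f := g)) as (gamma & _ & Eg).
  { apply (nq_imp Hg), (nq_imp (nq_large HQ Hb)), (nq_imp (nq_ordinal HQ)), nq_all.
    intros i Oi Hbi [Hgi _]. exact (ordinal_trans Oi Hgi Hbi). }
  destruct (nq_witness HQ (nq_and HQ Hg Eg)) as (i0 & [Hgb _] & E0).
  rewrite E0 in Hgb.
  (* Transitivity of [kappa] is not at hand in this context; instead the constant function [gamma]
     is regressive, and its almost constant value lies in [kappa]. *)
  assert (Hgk : gamma ∈ kappa).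
  { destruct (nq_regressive (f := fun _ => gamma)) as (g' & Hg' & E).
    - apply (nq_imp (nq_large HQ Hb)), (nq_imp (nq_ordinal HQ)), nq_all.
      intros i Oi Hbi. exact (ordinal_trans Oi Hgb Hbi).
    - destruct (nq_witness HQ E) as [_ ->]. exact Hg'. }
  destruct (IH gamma Hgb Hgk y) as (d & Hd & Ed).
  { apply (nq_imp Hg), (nq_imp Eg), nq_all. now intros i <- [_ H]. }
  assert (HdV : in_V beta d) by now apply in_V_intro with gamma.
  destruct (nq_ultra HQ (fun i => d ∈ x i)) as [M|M];
    destruct (nq_witness HQ (nq_and HQ M (nq_and HQ Hy Ed)))
      as (i & Mi & [_ Hyi] & Ei);
    rewrite Ei in Hyi; apply Hyi.
  - split; [intros _|easy]. apply Hc. split; [now apply Hv|exact M].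
  - split; [easy|]. intros H. apply Hc in H.
    destruct (nq_witness HQ (nq_and HQ M (proj2 H))). tauto.
Qed.

Lemma nq_in_V (x : V -> V) : Q (fun i => in_V i (x i)) ->
  exists c beta, beta ∈ kappa /\ (forall y, y ∈ c -> in_V beta y) /\
    Q (fun i => x i = c).
Proof.
  intros H.
  destruct (nq_choice (R := fun i g =>
    g ∈ i /\ forall u, u ∈ x i -> in_V g u)) as [g Hg].
  { apply (nq_imp H), nq_all. intros i H'. inversion H' as [b' g y' Hg Hu].
    now exists g. }
  destruct (nq_regressive (f := g)) as (beta & Hb & Eg).
  { apply (nq_mono HQ Hg). tauto. }
  destruct (nq_in_V_bounded Hb (x := x)) as (c & Hc & E).
  { apply (nq_imp Hg), (nq_imp Eg), nq_all. now intros i <- [_ H']. }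
  now exists c, beta.
Qed.

Hypothesis Rk : regular kappa.

Lemma nq_limit : Q limit_ordinal.
Proof.
  destruct Rk as (_ & Lk & _). destruct Lk as (_ & [z Hz] & Hk).
  assert (D : Q (fun i => forall delta, delta ∈ i ->
    exists gamma, gamma ∈ i /\ delta ∈ gamma)).
  { apply (nq_diagonal HQ (P := fun delta i =>
      exists gamma, gamma ∈ i /\ delta ∈ gamma)).
    intros delta Hd. destruct (Hk delta Hd) as (g & Hg & Hdg).
    apply (nq_mono HQ (nq_large HQ Hg)). intros i Hi. now exists g. }
  apply (nq_imp (nq_large HQ Hz)), (nq_imp (nq_ordinal HQ)), (nq_imp D), nq_all.
  intros i Hi Oi Hzi. split; [exact Oi|]. split; [now exists z|exact Hi].
Qed.

(** The indices are carried into [kappa] by a strictly increasing sequence [num], and the conditions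
    are diagonalised along it. Almost every [i] contains [z] and is closed under [next], so it
    contains every [num n]. *)
Lemma nq_nat (P : nat -> V -> Prop) :
  (forall n, Q (P n)) -> Q (fun i => forall n, P n i).
Proof.
  intros H. destruct Rk as (_ & Lk & _). destruct Lk as (Ok & [z Hz] & Hk).
  destruct (total_choice (fun d g => g ∈ kappa /\ d ∈ g) V_inhabited)
    as [next Hnext].
  pose (num := nat_rect (fun _ => carrier V) z (fun _ => next)).
  assert (Hk' : forall n, num n ∈ kappa).
  { induction n as [|n IH]; [exact Hz|]. simpl. now apply Hnext, Hk. }
  assert (Hmono : forall m n, m < n -> num m ∈ num n).
  { intros m n Hmn. induction Hmn as [|n Hmn IH]; simpl.
    - apply Hnext, Hk, Hk'.
    - assert (Hn : num n ∈ next (num n)) by apply Hnext, Hk, Hk'.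
      apply (ordinal_trans (ordinal_el Ok (Hk' (S n))) IH Hn). }
  assert (Hinj : forall m n, num m = num n -> m = n).
  { intros m n E. destruct (PeanoNat.Nat.lt_trichotomy m n) as [H'|[H'|H']];
      [|exact H'|]; apply Hmono in H'; rewrite E in H'; destruct (mem_irrefl H'). }
  assert (D : Q (fun i => forall d, d ∈ i -> forall n, d = num n -> P n i)).
  { apply (nq_diagonal HQ (P := fun d i => forall n, d = num n -> P n i)).
    intros d _. destruct (classic (exists n, d = num n)) as [[n ->]|N].
    - apply (nq_mono HQ (H n)). intros i Hi m E. now apply Hinj in E as <-.
    - apply nq_all. intros i n ->. destruct N. now exists n. }
  assert (D' : Q (fun i => forall d, d ∈ i -> next d ∈ i)).
  { apply (nq_diagonal HQ (P := fun d i => next d ∈ i)).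
    intros d Hd. apply (nq_large HQ). now apply Hnext, Hk. }
  apply (nq_imp D), (nq_imp D'), (nq_imp (nq_large HQ Hz)), nq_all.
  intros i Hzi Hi Hd n. apply (Hd (num n)); [|reflexivity].
  induction n as [|n IH]; [exact Hzi|]. simpl. now apply Hi.
Qed.

(** Countable completeness makes the ultrapower of the subformula relation
    well-founded. *)
Lemma family_ind (P : (V -> form V) -> Prop) :
  (forall phi, (forall psi, Q (fun i => sub_form (psi i) (phi i)) -> P psi) ->
     P phi) ->
  forall phi, P phi.
Proof.
  intros IH phi. apply NNPP. intros N.
  assert (inh : inhabited (V -> form V)) by exact (inhabits phi).
  destruct (total_choice (fun phi psi =>
    Q (fun i => sub_form (psi i) (phi i)) /\ ~ P psi) inh) as [next Hnext].
  assert (Hnext' : forall phi, ~ P phi ->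
    Q (fun i => sub_form (next phi i) (phi i)) /\ ~ P (next phi)).
  { intros chi Hchi. apply Hnext. apply NNPP. intros N'. apply Hchi, IH.
    intros psi Hpsi. apply NNPP. intros N''. apply N'. now exists psi. }
  pose (chain := nat_rect (fun _ => V -> form V) phi (fun _ => next)).
  assert (Hchain : forall n, ~ P (chain n)).
  { induction n as [|n IHn]; [exact N|]. simpl. now apply Hnext'. }
  (* A single [i] serves every [n], and there the chain of families is a genuine infinite descent
     through subformulas. *)
  destruct (nq_witness HQ (nq_nat (fun n => proj1 (Hnext' _ (Hchain n)))))
    as [i Hi].
  assert (C : forall psi n, psi = chain n i -> False).
  { intros psi. induction (sub_form_wf psi) as [psi _ IHpsi]. intros n ->.
    exact (IHpsi (chain (S n) i) (Hi n) (S n) eq_refl). }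
  exact (C _ 0 eq_refl).
Qed.

(** Choose at each bad [i] a short unbounded map. Its domain is almost always a fixed [beta], and
    each of its values a fixed [g d]; regularity of [kappa] bounds [g] by some [gamma], which then
    bounds the map at some [i] containing [gamma]. *)
Lemma nq_regular : Q regular.
Proof.
  destruct Rk as (_ & _ & Hk). destruct (nq_ultra HQ regular) as [|N]; [assumption|].
  exfalso.
  destruct (nq_choice (R := fun i (bf : V * (V -> V)) =>
    fst bf ∈ i /\ (forall delta, delta ∈ fst bf -> snd bf delta ∈ i) /\
    forall gamma, gamma ∈ i ->
      exists delta, delta ∈ fst bf /\ ~ snd bf delta ∈ gamma)) as [bf Hbf].
  { apply (nq_imp nq_limit), (nq_imp N), nq_all. intros i Ni Li.
    apply NNPP. intros N'. apply Ni. apply limit_regular_cardinal; [exact Li|].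
    intros beta f Hb Hf. apply NNPP. intros N''. apply N'.
    exists (beta, f). simpl. repeat split; auto.
    intros gamma Hg. apply NNPP. intros N3. apply N''. exists gamma.
    split; [exact Hg|]. intros d Hd. apply NNPP. intros N4. apply N3.
    now exists d. }
  destruct (nq_regressive (f := fun i => fst (bf i))) as (beta & Hb & Eb).
  { apply (nq_mono HQ Hbf). tauto. }
  destruct (total_choice (fun d c => c ∈ kappa /\ Q (fun i => snd (bf i) d = c))
    V_inhabited) as [g Hg].
  assert (Hg' : forall d, d ∈ beta ->
    g d ∈ kappa /\ Q (fun i => snd (bf i) d = g d)).
  { intros d Hd. apply Hg. apply nq_regressive.
    apply (nq_imp Hbf), (nq_imp Eb), nq_all. intros i <- Hi. now apply Hi. }
  destruct (Hk beta g Hb (fun d Hd => proj1 (Hg' d Hd))) as (gamma & Hgk & Hgg).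
  assert (C := nq_complete Hb (fun d Hd => proj2 (Hg' d Hd))).
  destruct (nq_witness HQ (nq_and HQ (nq_and HQ C Eb)
    (nq_and HQ Hbf (nq_large HQ Hgk)))) as (i & [Ci Ei] & (_ & _ & Hi) & Hgi).
  destruct (Hi gamma Hgi) as (d & Hd & Nd). rewrite Ei in Hd.
  apply Nd. rewrite Ci by exact Hd. now apply Hgg.
Qed.

End Quantifier.

(** * The two instances: evaluation at [kappa] and a normal measure *)

Lemma nq_at (V : ZFC) (kappa : V) :
  ordinal kappa -> normal_quantifier kappa (fun P => P kappa).
Proof.
  intros Ok. constructor; auto.
  - intros P. apply classic.
  - intros P H. now exists kappa.
Qed.

Section Measure.
Context {V : ZFC} (kappa U : V).
Hypothesis Ok : ordinal kappa.
Hypothesis HU : normal_measure kappa U.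

Notation ae P := (sep_in kappa P U).

Lemma ae_mono (P R : V -> Prop) : ae P -> (forall i, P i -> R i) -> ae R.
Proof.
  destruct HU as (((Hsub & _ & _ & _ & Hup & _) & _) & _).
  intros (X & HX & EX) H. destruct (separation kappa R) as [Y HY].
  exists Y. split; [|exact HY]. apply Hup with X; auto.
  - intros x Hx. apply EX in Hx. apply HY. firstorder.
  - intros x Hx. now apply HY.
Qed.

Lemma ae_and (P R : V -> Prop) : ae P -> ae R -> ae (fun i => P i /\ R i).
Proof.
  destruct HU as (((_ & _ & _ & Hint & _) & _) & _).
  intros (X & HX & EX) (Y & HY & EY). destruct (Hint X Y HX HY) as (Z & HZ & EZ).
  exists Z. split; [exact HZ|]. intros x. rewrite EZ, EX, EY. tauto.
Qed.

Lemma ae_ultra (P : V -> Prop) : ae P \/ ae (fun i => ~ P i).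
Proof.
  destruct HU as (((_ & _ & _ & _ & _ & Hultra) & _) & _).
  destruct (separation kappa P) as [X HX].
  destruct (Hultra X) as [H|(Y & HY & EY)].
  - intros x Hx. now apply HX.
  - left. now exists X.
  - right. exists Y. split; [exact HY|]. intros x. rewrite EY, HX. tauto.
Qed.

Lemma ae_kappa : ae (fun i => i ∈ kappa).
Proof.
  destruct HU as (((_ & Hk & _) & _) & _).
  exists kappa. split; [exact Hk|]. tauto.
Qed.

Lemma ae_witness (P : V -> Prop) : ae P -> exists i, i ∈ kappa /\ P i.
Proof.
  destruct HU as (((_ & _ & Hne & _) & _) & _).
  intros (X & HX & EX). destruct (Hne X HX) as [x Hx]. exists x. now apply EX.
Qed.

Lemma ae_sets theta (P : V -> V -> Prop) :
  (forall delta, delta ∈ theta -> ae (P delta)) ->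
  exists A : V -> V, forall delta, delta ∈ theta -> A delta ∈ U /\
    forall x, x ∈ A delta <-> x ∈ kappa /\ P delta x.
Proof.
  intros H. destruct (total_choice (fun delta X => X ∈ U /\
    forall x, x ∈ X <-> x ∈ kappa /\ P delta x) V_inhabited) as [A HA].
  exists A. intros delta Hd. apply HA. exact (H delta Hd).
Qed.

Lemma ae_complete beta (P : V -> V -> Prop) : beta ∈ kappa ->
  (forall delta, delta ∈ beta -> ae (P delta)) ->
  ae (fun i => forall delta, delta ∈ beta -> P delta i).
Proof.
  destruct HU as ((_ & _ & Hc) & _). intros Hb H.
  destruct (ae_sets H) as [A HA].
  refine (ae_mono (Hc beta A Hb (fun d Hd => proj1 (HA d Hd))) _).
  intros i Hi d Hd. apply (HA d Hd). auto.
Qed.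

Lemma ae_diagonal (P : V -> V -> Prop) :
  (forall delta, delta ∈ kappa -> ae (P delta)) ->
  ae (fun i => forall delta, delta ∈ i -> P delta i).
Proof.
  destruct HU as (_ & Hn). intros H. destruct (ae_sets H) as [A HA].
  refine (ae_mono (ae_and ae_kappa (Hn A (fun d Hd => proj1 (HA d Hd)))) _).
  intros i [Hik Hi] d Hd. apply (HA d); [exact (ordinal_trans Ok Hd Hik)|]. auto.
Qed.

(** Nonprincipality discards each single point up to [gamma], and completeness discards them all
    together. *)
Lemma ae_large gamma : gamma ∈ kappa -> ae (fun i => gamma ∈ i).
Proof.
  intros Hg. destruct HU as ((_ & Hnp & _) & _).
  assert (Hne : forall d, d ∈ kappa -> ae (fun i => i <> d)).
  { intros d Hd. destruct (ae_ultra (fun i => i = d)) as [E|N]; [|exact N].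
    destruct (Hnp d Hd E). }
  assert (Hall : ae (fun i => forall d, d ∈ gamma -> i <> d)).
  { apply ae_complete; [exact Hg|]. intros d Hd. apply Hne.
    exact (ordinal_trans Ok Hd Hg). }
  refine (ae_mono (ae_and ae_kappa (ae_and (Hne gamma Hg) Hall)) _).
  intros i (Hi & Ni & Hi').
  destruct (ordinal_total (ordinal_el Ok Hi) (ordinal_el Ok Hg)) as [H|[H|H]].
  - now destruct (Hi' i H).
  - now destruct Ni.
  - exact H.
Qed.

Lemma nq_measure : normal_quantifier kappa (fun P => ae P).
Proof.
  constructor.
  - exact ae_mono.
  - exact ae_and.
  - exact ae_ultra.
  - intros P H. destruct (ae_witness H) as (i & _ & Hi). now exists i.
  - exact ae_diagonal.
  - exact ae_large.
  - refine (ae_mono ae_kappa _). intros i. now apply ordinal_el.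
Qed.

(** A map from [beta] into [kappa] has fewer than [kappa] values, so almost every [i] lies above all
    of them. *)
Lemma measure_regular : cardinal kappa -> regular kappa.
Proof.
  intros Ck. split; [exact Ck|]. split; [split; [exact Ok|split]|].
  - destruct (ae_witness ae_kappa) as (i & Hi & _). now exists i.
  - intros beta Hb. destruct (ae_witness (ae_large Hb)) as (i & Hi & H).
    now exists i.
  - intros beta f Hb Hf.
    destruct (ae_witness (ae_complete (P := fun d i => f d ∈ i) Hb
      (fun d Hd => ae_large (Hf d Hd)))) as (i & Hi & H).
    now exists i.
Qed.

End Measure.

(** * Restriction of formulas *)

Lemma sat_agree (V : ZFC) (alpha : V) (phi : form V) : forall s s' : V -> V,
  (forall v, free v phi -> s v = s' v) -> (sat alpha phi s <-> sat alpha phi s').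
Proof.
  assert (H : forall (phi : form V) s s',
    (forall v, free v phi -> s v = s' v) -> sat alpha phi s -> sat alpha phi s').
  2:{ intros s s' E. split; apply H; auto. intros v Hv. symmetry. auto. }
  clear phi. intros phi.
  induction phi as [i j|i j|phi IH|xi f IH|gamma a phi IH]; simpl; intros s s' E.
  - rewrite (E i), (E j); auto.
  - rewrite (E i), (E j); auto.
  - intros H H'. apply H. apply IH with s'; [|exact H'].
    intros v Hv. symmetry. auto.
  - intros H z. apply IH with s; [|apply H]. intros v Hv. apply E. now exists z.
  - intros (t & Ht & Ht' & Hsat).
    exists (fun v => if excluded_middle_informative (exists eta, v = a eta)
      then t v else s' v). repeat split.
    + intros eta. destruct excluded_middle_informative as [_|N]; [apply Ht|].
      destruct N. now exists eta.
    + intros v Hv. now destruct excluded_middle_informative.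
    + apply IH with t; [|exact Hsat]. intros v Hv.
      destruct excluded_middle_informative as [_|N]; [reflexivity|].
      rewrite Ht' by exact N. now apply E.
Qed.

Lemma free_in_L (V : ZFC) (beta v : V) (phi : form V) :
  in_L beta phi -> free v phi -> v ∈ beta.
Proof.
  induction phi as [i j|i j|phi IH|xi f IH|gamma a phi IH]; simpl.
  - now intros [Hi Hj] [-> | ->].
  - now intros [Hi Hj] [-> | ->].
  - exact IH.
  - intros [_ H] [z Hz]. now apply (IH z).
  - intros (_ & _ & _ & H) [Hv _]. auto.
Qed.

Lemma sat_agree_in_L (V : ZFC) (beta : V) (phi : form V) (s s' : V -> V) :
  in_L beta phi -> (forall v, v ∈ beta -> s v = s' v) ->
  (sat beta phi s <-> sat beta phi s').
Proof.
  intros H E. apply sat_agree. intros v Hv. apply E. now apply free_in_L with phi.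
Qed.

Section Restriction.
Context {V : ZFC} (b : V -> V -> V -> V).
Hypothesis hb : bijection_choice b.

(** Treats both clauses of [F] as initial segments of one enumeration of length [i]. When [xi] is
    below [i] the enumeration runs beyond [xi], so membership of the value in [xi] has to be
    required separately. *)
Definition index (i xi delta : V) : V :=
  if excluded_middle_informative (xi ∈ i) then delta else b i xi delta.

(** For [xi] below [i], [F] is the whole of [xi], which the indices below [beta] exhaust once [xi]
    is below [beta]; hence the last hypothesis. *)
Lemma F_index (i xi beta z : V) :
  regular i -> beta ∈ i -> below_successor i xi -> (xi ∈ i -> xi ∈ beta) ->
  (F b i xi beta z <-> z ∈ xi /\ exists delta, delta ∈ beta /\ z = index i xi delta).
Proof.
  intros Ri Hb Hxi Hxb. assert (Oi := proj1 (proj1 Ri)). unfold index, F.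
  destruct excluded_middle_informative as [H|N].
  - split.
    + intros [[_ Hz] | [Hle _]].
      * split; [exact Hz|]. exists z. split; [|reflexivity].
        exact (ordinal_trans (ordinal_el Oi Hb) Hz (Hxb H)).
      * destruct Hle as [E | Hle].
        -- subst xi. destruct (mem_irrefl H).
        -- destruct (mem_asym H Hle).
    + intros [Hz _]. now left.
  - split.
    + intros [[H _] | [Hle (d & Hd & ->)]]; [easy|].
      split; [|now exists d].
      apply (proj1 (hb Ri)); auto. exact (ordinal_trans Oi Hd Hb).
    + intros [Hz (d & Hd & ->)]. right. split; [|now exists d].
      destruct (ordinal_total (below_successor_ordinal Hxi) Oi) as [H|[H|H]].
      * easy.
      * now left.
      * now right.
Qed.

Lemma index_surjective (i xi z : V) :
  regular i -> below_successor i xi -> z ∈ xi ->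
  exists delta, delta ∈ i /\ index i xi delta = z.
Proof.
  intros Ri Hxi Hz. assert (Oi := proj1 (proj1 Ri)). unfold index.
  destruct excluded_middle_informative as [H|N].
  - exists z. split; [|reflexivity]. exact (ordinal_trans Oi Hz H).
  - apply (proj1 (hb Ri)); auto.
    destruct (ordinal_total (below_successor_ordinal Hxi) Oi) as [H|[H|H]].
    + easy.
    + now left.
    + now right.
Qed.

Lemma restriction_conj (i xi beta : V) (f : V -> form V) :
  regular i -> beta ∈ i -> below_successor i xi -> (xi ∈ i -> xi ∈ beta) ->
  (forall z, F b i xi beta z ->
     exists chi, restriction b i beta (f z) chi /\ in_L beta chi) ->
  exists chi, restriction b i beta (Conj xi (fun z : el xi => f (val z))) chi /\
    in_L beta chi.
Proof.
  intros Ri Hb Hxi Hxb H.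
  assert (Fi := fun z => F_index z Ri Hb Hxi Hxb).
  assert (Oxi := below_successor_ordinal Hxi).
  assert (Fxi : forall z, F b i xi beta z -> z ∈ xi) by (intros z Hz; now apply Fi).
  assert (OF : forall z, F b i xi beta z -> ordinal z).
  { intros z Hz. exact (ordinal_el Oxi (Fxi z Hz)). }
  destruct (collapse_exists (F b i xi beta)) as [p Hp].
  assert (Hp' : transitive_collapse (F b i xi beta) p) by (intros z _; apply Hp).
  destruct (collapse_order_type OF Fxi Hp') as (theta & Hot & Ht).
  (* [g] is indexed by collapsed positions; injectivity of [p] makes it independent of the preimage
     chosen. *)
  destruct (total_choice (fun zeta chi => exists z, F b i xi beta z /\ p z = zeta /\
    restriction b i beta (f z) chi /\ in_L beta chi) (inhabits (Mem i i)))
    as [g Hg].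
  assert (Hg' : forall z, F b i xi beta z ->
    restriction b i beta (f z) (g (p z)) /\ in_L beta (g (p z))).
  { intros z Hz. destruct (Hg (p z)) as (z' & Hz' & E & Hr).
    { destruct (H z Hz) as (chi & Hr). now exists chi, z. }
    rewrite (collapse_inj OF Hp' Hz' Hz E) in Hr. exact Hr. }
  exists (Conj theta (fun zeta : el theta => g (val zeta))).
  assert (HL : in_L beta (Conj theta (fun zeta : el theta => g (val zeta)))).
  { split.
    (* The map [p] after [index] covers [theta] from [beta], so the new conjunction is short enough
       for [beta]. *)
    - apply (below_successor_surjection (f := fun d => p (index i xi d))
        (proj1 Ri) Hb (proj1 Hot)).
      intros v Hv. apply Ht in Hv. destruct Hv as (z & Hz & ->).
      apply Fi in Hz. destruct Hz as (_ & d & Hd & ->). now exists d.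
    - intros [zeta Hz]. simpl. apply Ht in Hz. destruct Hz as (z & Hz & ->).
      now apply Hg'. }
  split; [|exact HL].
  exists theta, (fun zeta : el theta => g (val zeta)), p.
  split; [exact Hot|]. split; [exact Hp'|]. split; [|now split].
  intros z zeta Hz E. rewrite <- E. now apply Hg'.
Qed.

(** * Restriction of a single existential formula *)

Section Exists.
Variables (i gamma beta : V) (a : V -> V) (psi : form V).
Hypothesis Oi : ordinal i.
Hypothesis Hb : beta ∈ i.
Hypothesis HL : in_L i (Ex gamma (fun z : el gamma => a (val z)) psi).

Lemma ex_bound_ordinal : ordinal gamma.
Proof. destruct HL as [[-> | H] _]; [exact Oi|exact (ordinal_el Oi H)]. Qed.

Lemma ex_var_in (eta : V) : eta ∈ gamma -> a eta ∈ i.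
Proof. intros H. exact (proj1 (proj2 HL) (exist _ eta H)). Qed.

Lemma ex_var_mono (eta eta' : V) :
  eta ∈ gamma -> eta' ∈ gamma -> eta ∈ eta' -> a eta ∈ a eta'.
Proof.
  intros H H'.
  exact (proj1 (proj2 (proj2 HL)) (exist _ eta H) (exist _ eta' H')).
Qed.

(** Since [eta <= a eta], a quantified variable below [beta] is still quantified
    after restriction to [beta]. *)
Lemma ex_var_below (eta : V) : eta ∈ gamma -> a eta ∈ beta -> eta ∈ beta.
Proof.
  intros H Ha.
  destruct (increasing_ge ex_bound_ordinal (a := a)
    (fun eta He => ordinal_el Oi (ex_var_in He)) ex_var_mono H) as [E|H'].
  - now rewrite E.
  - exact (ordinal_trans (ordinal_el Oi Hb) H' Ha).
Qed.

Lemma restriction_ex psi' :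
  (forall eta, eta ∈ beta -> eta ∈ gamma -> a eta ∈ beta) ->
  restriction b i beta psi psi' -> in_L beta psi' ->
  exists chi, restriction b i beta (Ex gamma (fun z : el gamma => a (val z)) psi) chi
    /\ in_L beta chi.
Proof.
  intros Ha Hr HL'. destruct (separation beta (fun eta => eta ∈ gamma)) as [g Hg].
  exists (Ex g (fun z : el g => a (val z)) psi').
  assert (HLg : in_L beta (Ex g (fun z : el g => a (val z)) psi')).
  { repeat split; auto.
    - destruct (ordinal_total ex_bound_ordinal (ordinal_el Oi Hb)) as [H|H].
      + right. replace g with gamma; [exact H|]. apply extensionality.
        intros z. rewrite Hg. split; [|easy]. intros Hz. split; [|exact Hz].
        exact (ordinal_trans (ordinal_el Oi Hb) Hz H).
      + left. apply extensionality. intros z. rewrite Hg. split; [easy|].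
        intros Hz. split; [exact Hz|]. destruct H as [-> | H]; [exact Hz|].
        exact (ordinal_trans ex_bound_ordinal Hz H).
    - intros [eta He]. simpl. now apply Ha; apply Hg.
    - intros [eta He] [eta' He']. simpl. now apply ex_var_mono; apply Hg. }
  split; [|exact HLg].
  exists g, (fun z : el g => a (val z)), psi'.
  split; [exact Hg|]. split; [|now split].
  intros eta eta' ->. reflexivity.
Qed.

(** Eliminates the restricted block of variables in favour of the original [a] and [gamma]. By
    [ex_var_below], a variable below [beta] is quantified before restriction iff it is afterwards,
    and [psi'] has no free variables elsewhere. *)
Lemma restriction_ex_inv chi :
  restriction b i beta (Ex gamma (fun z : el gamma => a (val z)) psi) chi ->
  in_L beta chi ->
  exists psi', restriction b i beta psi psi' /\ in_L beta psi' /\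
    (forall v, free v chi <->
       free v psi' /\ ~ exists eta, eta ∈ gamma /\ v = a eta) /\
    (forall s : V -> V, sat beta chi s <-> exists t : V -> V,
       (forall eta, eta ∈ beta -> eta ∈ gamma -> in_V beta (t (a eta))) /\
       (forall v, v ∈ beta -> (~ exists eta, eta ∈ gamma /\ v = a eta) -> t v = s v) /\
       sat beta psi' t).
Proof.
  intros (g & a' & psi' & Hg & Ha' & Hr & -> & _) (Hle & Hab & Hinc & HL').
  exists psi'. split; [exact Hr|]. split; [exact HL'|].
  assert (Hin : forall eta, eta ∈ beta -> eta ∈ gamma ->
    exists eta' : el g, a' eta' = a eta).
  { intros eta He He'. assert (H := proj2 (Hg eta) (conj He He')).
    exists (exist _ eta H). exact (Ha' (exist _ eta He') (exist _ eta H) eq_refl). }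
  assert (Hout : forall eta' : el g, exists eta, eta ∈ beta /\ eta ∈ gamma /\
    a' eta' = a eta).
  { intros [eta He]. destruct (proj1 (Hg eta) He) as [H1 H2].
    exists eta. repeat split; auto.
    exact (Ha' (exist _ eta H2) (exist _ eta He) eq_refl). }
  assert (Hrange : forall v, v ∈ beta -> (exists eta, eta ∈ gamma /\ v = a eta) ->
    exists eta', v = a' eta').
  { intros v Hv (eta & He & ->). destruct (Hin eta (ex_var_below He Hv) He) as [e' E].
    now exists e'. }
  assert (Hrange' : forall v, (exists eta', v = a' eta') ->
    exists eta, eta ∈ gamma /\ v = a eta).
  { intros v [e' ->]. destruct (Hout e') as (eta & _ & H & E). now exists eta. }
  split.
  - intros v. simpl. split; intros [Hv N]; split; auto.
    intros H. apply N. apply Hrange; [|exact H]. now apply free_in_L with psi'.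
  - intros s. simpl. split.
    + intros (t & Ht & Ht' & Hs). exists t. repeat split; auto.
      intros eta He He'. destruct (Hin eta He He') as [e' <-]. apply Ht.
    + intros (t & Ht & Ht' & Hs).
      (* [t] is controlled only below [beta]; elsewhere it is reset to [s], which [psi'] cannot
         notice. *)
      exists (fun v => if excluded_middle_informative (v ∈ beta)
        then t v else s v). repeat split.
      * intros e'. destruct excluded_middle_informative as [_|N].
        -- destruct (Hout e') as (eta & He & He' & ->). now apply Ht.
        -- destruct N. apply Hab.
      * intros v Hv. destruct excluded_middle_informative as [Hvb|_]; [|easy].
        apply Ht'; [exact Hvb|]. intros N. now apply Hv, Hrange.
      * apply (sat_agree_in_L (s := t)); auto.
        intros v Hv. now destruct excluded_middle_informative.
Qed.

End Exists.

(** Makes the restriction of a sentence a sentence, so that truth under one assignment gives truth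
    under all. *)
Lemma restriction_free (i beta : V) (phi : form V) :
  regular i -> beta ∈ i -> forall chi v, in_L i phi ->
  restriction b i beta phi chi -> in_L beta chi -> free v chi -> free v phi.
Proof.
  intros Ri Hb. assert (Oi := proj1 (proj1 Ri)).
  induction phi as [x y|x y|phi IH|xi f IH|gamma a phi IH]; intros chi v HL Hr HL' Hv.
  - simpl in Hr. now subst chi.
  - simpl in Hr. now subst chi.
  - destruct Hr as (psi' & Hr & ->). exact (IH psi' v HL Hr HL' Hv).
  - destruct Hr as (theta & phi' & p & Hot & Hp & Hr & -> & _).
    destruct Hv as [zeta Hv].
    destruct (proj2 (collapse_onto Hot Hp) zeta (proj2_sig zeta)) as (z & Hz & E).
    assert (Hxi : z ∈ xi).
    { destruct Hz as [[_ Hz] | [Hle (d & Hd & ->)]]; [exact Hz|].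
      apply (proj1 (hb Ri)); auto; [apply HL|]. exact (ordinal_trans Oi Hd Hb). }
    exists (exist _ z Hxi).
    exact (IH _ _ v (proj2 HL _) (Hr (exist _ z Hxi) zeta Hz E) (proj2 HL' _) Hv).
  - destruct (total_extension a V_inhabited) as [a' ->].
    destruct (restriction_ex_inv Oi Hb HL Hr HL') as (psi' & Hr' & HLp & Hf & _).
    apply Hf in Hv. destruct Hv as [Hv N]. split.
    + refine (IH psi' v _ Hr' HLp Hv). apply HL.
    + intros [[eta He] E]. apply N. now exists eta.
Qed.

End Restriction.

(** The components are packed into tuples so that one application of [nq_choice] turns them into
    families. *)
Lemma form_shape (V : ZFC) (phi : form V) :
  (exists xy, phi = Mem (fst xy) (snd xy)) \/
  (exists xy, phi = Eq (fst xy) (snd xy)) \/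
  (exists psi, phi = Neg psi) \/
  (exists xf : V * (V -> form V),
     phi = Conj (fst xf) (fun z : el (fst xf) => snd xf (val z))) \/
  (exists gap : V * (V -> V) * form V, phi =
     Ex (fst (fst gap)) (fun z : el (fst (fst gap)) => snd (fst gap) (val z)) (snd gap)).
Proof.
  destruct phi as [x y|x y|psi|xi f|gamma a psi].
  - left. now exists (x, y).
  - right; left. now exists (x, y).
  - right; right; left. now exists psi.
  - right; right; right; left.
    destruct (total_extension f (inhabits (Mem xi xi))) as [f' ->].
    now exists (xi, f').
  - right; right; right; right.
    destruct (total_extension a V_inhabited) as [a' ->].
    now exists (gamma, a', psi).
Qed.

(** * Reflection *)

Section Reflection.
Context {V : ZFC} (b : V -> V -> V -> V) (kappa : V).
Context (W Q : (V -> Prop) -> Prop).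
Hypothesis hb : bijection_choice b.
Hypothesis HW : normal_quantifier kappa W.
Hypothesis HQ : normal_quantifier kappa Q.
Hypothesis W_kappa : W (fun beta => beta ∈ kappa).
Hypothesis Rk : regular kappa.

(** The order matters: with [beta] fixed first, almost every [i] lies above it. *)
Definition ae2 (P : V -> V -> Prop) : Prop := W (fun beta => Q (P beta)).

Lemma ae2_all (P : V -> V -> Prop) : (forall beta i, P beta i) -> ae2 P.
Proof. intros H. apply (nq_all HW). intros beta. now apply (nq_all HQ). Qed.

Lemma ae2_imp (P R : V -> V -> Prop) :
  ae2 P -> ae2 (fun beta i => P beta i -> R beta i) -> ae2 R.
Proof.
  intros H H'. apply (nq_imp HW H), (nq_imp HW H'), (nq_all HW).
  intros beta H1 H2. exact (nq_imp HQ H2 H1).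
Qed.

Lemma ae2_left (P : V -> Prop) : W P -> ae2 (fun beta _ => P beta).
Proof.
  intros H. apply (nq_mono HW H). intros beta Hb. now apply (nq_all HQ).
Qed.

Lemma ae2_right (P : V -> Prop) : Q P -> ae2 (fun _ i => P i).
Proof. intros H. now apply (nq_all HW). Qed.

Lemma ae2_witness (P : V -> V -> Prop) :
  ae2 P -> exists beta i, beta ∈ kappa /\ P beta i.
Proof.
  intros H. destruct (nq_witness HW (nq_and HW W_kappa H)) as (beta & Hb & Hi).
  destruct (nq_witness HQ Hi) as (i & Hi'). now exists beta, i.
Qed.

Lemma ae2_not (P : V -> V -> Prop) : ~ ae2 P -> ae2 (fun beta i => ~ P beta i).
Proof.
  intros N. apply (nq_mono HW (nq_not HW N)). intros beta. apply (nq_not HQ).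
Qed.

Lemma ae2_choice (B : Type) (R : V -> V -> B -> Prop) :
  ae2 (fun beta i => exists x, R beta i x) ->
  exists f : V -> V -> B, ae2 (fun beta i => R beta i (f beta i)).
Proof.
  intros H. destruct (ae2_witness H) as (_ & _ & _ & x & _).
  destruct (total_choice (fun p x => R (fst p) (snd p) x) (inhabits x)) as [f Hf].
  exists (fun beta i => f (beta, i)). apply (ae2_imp H), ae2_all.
  intros beta i. exact (Hf (beta, i)).
Qed.

(** W diagonalises over [delta] below [beta]; then, with [beta] fixed in [kappa], completeness of Q
    merges the resulting conditions on [i]. *)
Lemma ae2_diagonal (P : V -> V -> V -> Prop) :
  (forall delta, delta ∈ kappa -> ae2 (P delta)) ->
  ae2 (fun beta i => forall delta, delta ∈ beta -> P delta beta i).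
Proof.
  intros H.
  assert (D := nq_diagonal HW (P := fun delta beta => Q (P delta beta)) H).
  apply (nq_imp HW W_kappa), (nq_mono HW D).
  intros beta Hd Hb. now apply (nq_complete HQ).
Qed.

Lemma ae2_mem : ae2 (fun beta i => beta ∈ i).
Proof. apply (nq_mono HW W_kappa). intros beta. apply (nq_large HQ). Qed.

Lemma ae2_regressive (f : V -> V) :
  Q (fun i => f i ∈ i) -> ae2 (fun beta i => f i ∈ beta).
Proof.
  intros H. destruct (nq_regressive HQ H) as (gamma & Hg & E).
  apply (ae2_imp (ae2_right E)), (ae2_imp (ae2_left (nq_large HW Hg))), ae2_all.
  now intros beta i H' ->.
Qed.

Lemma ae2_in_V (x : V -> V) :
  Q (fun i => in_V i (x i)) -> ae2 (fun beta i => in_V beta (x i)).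
Proof.
  intros H. destruct (nq_in_V HQ H) as (c & d & Hd & Hc & E).
  apply (ae2_imp (ae2_right E)), (ae2_imp (ae2_left (nq_large HW Hd))), ae2_all.
  intros beta i Hb ->. now apply in_V_intro with d.
Qed.

(** Pressing down twice: for fixed [beta] the value is almost always some [c beta] in V_beta, and
    then [c] itself is almost constant. *)
Lemma ae2_in_V_constant (x : V -> V -> V) :
  ae2 (fun beta i => in_V beta (x beta i)) ->
  exists c, Q (fun i => in_V i c) /\ ae2 (fun beta i => x beta i = c).
Proof.
  intros H.
  destruct (nq_choice HW (R := fun beta c =>
    in_V beta c /\ Q (fun i => x beta i = c))) as [c Hc].
  { apply (nq_imp HW H), (nq_imp HW W_kappa), (nq_all HW). intros beta Hb Hx.
    destruct (nq_in_V HQ (x := x beta)) as (c & _ & _ & _ & E).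
    - apply (nq_imp HQ Hx), (nq_imp HQ (nq_large HQ Hb)),
        (nq_imp HQ (nq_ordinal HQ)), (nq_all HQ).
      intros i Oi Hbi. now apply in_V_mono.
    - exists c. split; [|exact E].
      destruct (nq_witness HQ (nq_and HQ Hx E)) as (i & Hi & <-). exact Hi. }
  destruct (nq_in_V HW (x := c)) as (c0 & d & Hd & Hc0 & E).
  { apply (nq_mono HW Hc). tauto. }
  exists c0. split.
  - apply (nq_mono HQ (nq_large HQ Hd)). intros i Hi. now apply in_V_intro with d.
  - apply (nq_imp HW Hc), (nq_imp HW E), (nq_all HW). now intros beta <- [_ H'].
Qed.

Definition good (beta i : V) : Prop := regular i /\ beta ∈ i /\ ordinal beta.

Lemma ae2_good : ae2 good.
Proof.
  apply (ae2_imp (ae2_right (nq_regular HQ Rk))),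
    (ae2_imp ae2_mem), ae2_all.
  intros beta i Hb Ri. split; [exact Ri|split; [exact Hb|]].
  exact (ordinal_el (proj1 (proj1 Ri)) Hb).
Qed.

Lemma good_ordinal beta i : good beta i -> ordinal i.
Proof. intros [Ri _]. apply Ri. Qed.

Lemma ae2_F_index (xi : V -> V) : Q (fun i => below_successor i (xi i)) ->
  ae2 (fun beta i => (xi i ∈ i -> xi i ∈ beta) /\ forall z, F b i (xi i) beta z <->
    z ∈ xi i /\ exists delta, delta ∈ beta /\ z = index b i (xi i) delta).
Proof.
  intros H.
  assert (H' : ae2 (fun beta i => xi i ∈ i -> xi i ∈ beta)).
  { destruct (nq_ultra HQ (fun i => xi i ∈ i)) as [H'|N].
    - apply (ae2_imp (ae2_regressive H')), ae2_all. auto.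
    - apply (ae2_imp (ae2_right N)), ae2_all. tauto. }
  apply (ae2_imp (ae2_right H)), (ae2_imp H'), (ae2_imp ae2_good), ae2_all.
  intros beta i (Ri & Hb & _) Hx Hxi. split; [exact Hx|].
  intros z. now apply F_index.
Qed.

(** Reduces a claim about all retained conjuncts to one about a single family of conjuncts: each
    [delta] yields the family of [delta]-th indices, and [ae2_diagonal] merges them. *)
Lemma ae2_F (xi : V -> V) (P : V -> V -> V -> Prop) :
  Q (fun i => below_successor i (xi i)) ->
  (forall z : V -> V, Q (fun i => z i ∈ xi i) -> ae2 (fun beta i => P beta i (z i))) ->
  ae2 (fun beta i => forall z, F b i (xi i) beta z -> P beta i z).
Proof.
  intros Hxi H.
  assert (D : ae2 (fun beta i => forall delta, delta ∈ beta ->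
    index b i (xi i) delta ∈ xi i -> P beta i (index b i (xi i) delta))).
  { apply (ae2_diagonal (P := fun delta beta i =>
      index b i (xi i) delta ∈ xi i -> P beta i (index b i (xi i) delta))).
    intros delta _.
    destruct (nq_ultra HQ (fun i => index b i (xi i) delta ∈ xi i)) as [H'|N].
    - apply (ae2_imp (H _ H')), ae2_all. auto.
    - apply (ae2_imp (ae2_right N)), ae2_all. tauto. }
  apply (ae2_imp D), (ae2_imp (ae2_F_index Hxi)), ae2_all.
  intros beta i [_ Hz] Hd z HF. apply Hz in HF. destruct HF as (HF & d & Hdb & ->).
  now apply Hd.
Qed.

Lemma family_shape (phi : V -> form V) :
  (exists xy, Q (fun i => phi i = Mem (fst (xy i)) (snd (xy i)))) \/
  (exists xy, Q (fun i => phi i = Eq (fst (xy i)) (snd (xy i)))) \/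
  (exists psi, Q (fun i => phi i = Neg (psi i))) \/
  (exists xi f, Q (fun i => phi i = Conj (xi i) (fun z : el (xi i) => f i (val z)))) \/
  (exists gamma a psi, Q (fun i => phi i =
     Ex (gamma i) (fun z : el (gamma i) => a i (val z)) (psi i))).
Proof.
  assert (H := nq_all HQ (fun i => form_shape (phi i))).
  apply (nq_or HQ) in H. destruct H as [H|H].
  { left. exact (nq_choice HQ H). }
  apply (nq_or HQ) in H. destruct H as [H|H].
  { right; left. exact (nq_choice HQ H). }
  apply (nq_or HQ) in H. destruct H as [H|H].
  { right; right; left. exact (nq_choice HQ H). }
  apply (nq_or HQ) in H. destruct H as [H|H]; apply (nq_choice HQ) in H.
  - right; right; right; left. destruct H as [xf H].
    now exists (fun i => fst (xf i)), (fun i => snd (xf i)).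
  - right; right; right; right. destruct H as [gap H].
    now exists (fun i => fst (fst (gap i))), (fun i => snd (fst (gap i))),
      (fun i => snd (gap i)).
Qed.

Lemma ae2_restriction (phi : V -> form V) : Q (fun i => in_L i (phi i)) ->
  ae2 (fun beta i => exists chi, restriction b i beta (phi i) chi /\ in_L beta chi).
Proof.
  revert phi.
  apply (family_ind HQ Rk (P := fun phi => Q (fun i => in_L i (phi i)) ->
    ae2 (fun beta i => exists chi, restriction b i beta (phi i) chi /\ in_L beta chi))).
  intros phi IH HL.
  destruct (family_shape phi) as [[xy E]|[[xy E]|[[psi E]|[(xi & f & E)|
    (gamma & a & psi & E)]]]].
  - assert (Hx : Q (fun i => fst (xy i) ∈ i)).
    { apply (nq_imp HQ HL), (nq_mono HQ E). now intros i -> [H _]. }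
    assert (Hy : Q (fun i => snd (xy i) ∈ i)).
    { apply (nq_imp HQ HL), (nq_mono HQ E). now intros i -> [_ H]. }
    apply (ae2_imp (ae2_right E)), (ae2_imp (ae2_regressive Hx)),
      (ae2_imp (ae2_regressive Hy)), ae2_all.
    intros beta i Hyb Hxb ->. now exists (Mem (fst (xy i)) (snd (xy i))).
  - assert (Hx : Q (fun i => fst (xy i) ∈ i)).
    { apply (nq_imp HQ HL), (nq_mono HQ E). now intros i -> [H _]. }
    assert (Hy : Q (fun i => snd (xy i) ∈ i)).
    { apply (nq_imp HQ HL), (nq_mono HQ E). now intros i -> [_ H]. }
    apply (ae2_imp (ae2_right E)), (ae2_imp (ae2_regressive Hx)),
      (ae2_imp (ae2_regressive Hy)), ae2_all.
    intros beta i Hyb Hxb ->. now exists (Eq (fst (xy i)) (snd (xy i))).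
  - apply (ae2_imp (ae2_right E)).
    refine (ae2_imp (IH psi _ _) _).
    + apply (nq_mono HQ E). now intros i ->.
    + apply (nq_imp HQ HL), (nq_mono HQ E). now intros i ->.
    + apply ae2_all. intros beta i (chi & Hr & HLc) ->. exists (Neg chi).
      split; [now exists chi|exact HLc].
  - assert (Hxi : Q (fun i => below_successor i (xi i))).
    { apply (nq_imp HQ HL), (nq_mono HQ E). now intros i -> [H _]. }
    assert (H : ae2 (fun beta i => forall z, F b i (xi i) beta z ->
      exists chi, restriction b i beta (f i z) chi /\ in_L beta chi)).
    { apply (ae2_F (P := fun beta i z => exists chi,
        restriction b i beta (f i z) chi /\ in_L beta chi) Hxi).
      intros z Hz. apply (IH (fun i => f i (z i))).
      - apply (nq_imp HQ Hz), (nq_mono HQ E). intros i -> Hi.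
        now exists (exist _ (z i) Hi).
      - apply (nq_imp HQ Hz), (nq_imp HQ HL), (nq_mono HQ E).
        intros i -> [_ H] Hi. exact (H (exist _ (z i) Hi)). }
    apply (ae2_imp (ae2_right E)), (ae2_imp H), (ae2_imp (ae2_right Hxi)),
      (ae2_imp (ae2_F_index Hxi)), (ae2_imp ae2_good), ae2_all.
    intros beta i (Ri & Hb & _) [Hx _] Hxi' Hz ->. now apply restriction_conj.
  - assert (HLE : Q (fun i => in_L i
      (Ex (gamma i) (fun z : el (gamma i) => a i (val z)) (psi i)))).
    { apply (nq_imp HQ HL), (nq_mono HQ E). now intros i ->. }
    (* For fixed [eta] the variable [a i eta] is regressive in [i]; so almost every [beta] is closed
       under the enumeration of variables. *)
    assert (Ha : ae2 (fun beta i => forall eta, eta ∈ beta ->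
      eta ∈ gamma i -> a i eta ∈ beta)).
    { apply (ae2_diagonal (P := fun eta beta i => eta ∈ gamma i -> a i eta ∈ beta)).
      intros eta _. destruct (nq_ultra HQ (fun i => eta ∈ gamma i)) as [H|N].
      - refine (ae2_imp (ae2_regressive (f := fun i => a i eta) _) _).
        + apply (nq_imp HQ H), (nq_mono HQ HLE). intros i HLi.
          exact (ex_var_in (a := a i) HLi (eta := eta)).
        + apply ae2_all. auto.
      - apply (ae2_imp (ae2_right N)), ae2_all. tauto. }
    apply (ae2_imp (ae2_right E)), (ae2_imp Ha), (ae2_imp (ae2_right HLE)),
      (ae2_imp ae2_good).
    refine (ae2_imp (IH psi _ _) _).
    + apply (nq_mono HQ E). now intros i ->.
    + apply (nq_mono HQ HLE). intros i H. apply H.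
    + apply ae2_all.
      intros beta i (chi & Hr & HLc) Hg HLi Ha' ->.
      apply restriction_ex with chi; auto; [exact (good_ordinal Hg)|apply Hg].
Qed.

(** Ranging over every [chi] separates truth from definedness, which is [ae2_restriction]. The same
    assignment serves both structures because atoms are evaluated without reference to the level. *)
Definition reflects (phi : V -> form V) : Prop :=
  forall s : V -> V -> V,
  Q (fun i => forall v, v ∈ i -> in_V i (s i v)) ->
  ae2 (fun beta i => forall chi, restriction b i beta (phi i) chi ->
    in_L beta chi -> (sat beta chi (s i) <-> sat i (phi i) (s i))).

(** If all conjuncts hold at almost every [i], their restrictions do too. Otherwise the index of a
    failing conjunct is regressive, so it falls below [beta] and that conjunct is among those
    retained. *)
Lemma reflects_conj (xi : V -> V) (f : V -> V -> form V) :
  Q (fun i => in_L i (Conj (xi i) (fun z : el (xi i) => f i (val z)))) ->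
  (forall z : V -> V, Q (fun i => z i ∈ xi i) -> reflects (fun i => f i (z i))) ->
  reflects (fun i => Conj (xi i) (fun z : el (xi i) => f i (val z))).
Proof.
  intros HL IH s Hs.
  assert (Hxi : Q (fun i => below_successor i (xi i))).
  { apply (nq_mono HQ HL). now intros i [H _]. }
  assert (H : ae2 (fun beta i => forall z, F b i (xi i) beta z ->
    forall chi, restriction b i beta (f i z) chi -> in_L beta chi ->
    (sat beta chi (s i) <-> sat i (f i z) (s i)))).
  { apply (ae2_F (P := fun beta i z => forall chi,
      restriction b i beta (f i z) chi -> in_L beta chi ->
      (sat beta chi (s i) <-> sat i (f i z) (s i))) Hxi).
    intros z Hz. now apply IH. }
  destruct (nq_ultra HQ (fun i =>
    forall z, z ∈ xi i -> sat i (f i z) (s i))) as [T|N].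
  - apply (ae2_imp H), (ae2_imp (ae2_right T)), (ae2_imp (ae2_F_index Hxi)), ae2_all.
    intros beta i [_ HF] Ti Hi chi (theta & phi' & p & Hot & Hp & Hr & -> & _) HLc.
    split.
    + intros _ z. apply Ti. exact (proj2_sig z).
    + intros _ zeta.
      destruct (proj2 (collapse_onto Hot Hp) zeta (proj2_sig zeta)) as (z & Hz & E).
      assert (Hzx : z ∈ xi i) by now apply HF.
      apply (Hi z Hz); [|apply HLc|now apply Ti].
      now apply (Hr (exist _ z Hzx)).
  - destruct (nq_choice HQ (R := fun i d => d ∈ i /\ index b i (xi i) d ∈ xi i /\
      ~ sat i (f i (index b i (xi i) d)) (s i))) as [d Hd].
    { apply (nq_imp HQ N), (nq_imp HQ Hxi),
        (nq_mono HQ (nq_regular HQ Rk)). intros i Ri Hxi' Ni.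
      apply NNPP. intros N'. apply Ni. intros z Hz. apply NNPP. intros Nz.
      destruct (index_surjective hb Ri Hxi' Hz) as (d & Hd & <-).
      apply N'. now exists d. }
    assert (Hdb : ae2 (fun beta i => d i ∈ beta)).
    { apply ae2_regressive. apply (nq_mono HQ Hd). tauto. }
    apply (ae2_imp H), (ae2_imp (ae2_right Hd)), (ae2_imp Hdb),
      (ae2_imp (ae2_F_index Hxi)), ae2_all.
    intros beta i [_ HF] Hdi (_ & Hdx & Nd) Hi chi
      (theta & phi' & p & Hot & Hp & Hr & -> & _) HLc.
    assert (HFd : F b i (xi i) beta (index b i (xi i) (d i))).
    { apply HF. split; [exact Hdx|]. now exists (d i). }
    split.
    + intros Hsat. destruct Nd.
      assert (Hpt := proj1 (collapse_onto Hot Hp) _ HFd).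
      pose (z := exist (fun v => v ∈ xi i) _ Hdx : el (xi i)).
      pose (zeta := exist (fun v => v ∈ theta) _ Hpt : el theta).
      refine (proj1 (Hi _ HFd (phi' zeta) _ (proj2 HLc zeta)) (Hsat zeta)).
      exact (Hr z zeta HFd eq_refl).
    + intros Hsat. destruct Nd.
      exact (Hsat (exist (fun v => v ∈ xi i) _ Hdx)).
Qed.

(** * Truth of existential formulas in families *)

Section Exists.
Context (gamma : V -> V) (a : V -> V -> V) (psi : V -> form V).
Hypothesis HL : Q (fun i => in_L i
  (Ex (gamma i) (fun z : el (gamma i) => a i (val z)) (psi i))).
Hypothesis IH : reflects psi.
Variable s : V -> V -> V.
Hypothesis Hs : Q (fun i => forall v, v ∈ i -> in_V i (s i v)).

(** The witness at [i] is reused at [beta]: each of its coordinates lies in V_i, hence almost always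
    in V_beta, and the coordinates below [beta] are handled diagonally. *)
Lemma reflects_ex_true (t : V -> V -> V) :
  Q (fun i => (forall eta, eta ∈ gamma i -> in_V i (t i (a i eta))) /\
    (forall v, (~ exists eta, eta ∈ gamma i /\ v = a i eta) -> t i v = s i v) /\
    sat i (psi i) (t i)) ->
  ae2 (fun beta i => forall chi, restriction b i beta
      (Ex (gamma i) (fun z : el (gamma i) => a i (val z)) (psi i)) chi ->
    in_L beta chi -> sat beta chi (s i)).
Proof.
  intros Ht.
  assert (Hgood : Q (fun i => forall v, v ∈ i -> in_V i (t i v))).
  { apply (nq_imp HQ Hs), (nq_mono HQ Ht). intros i (Ht1 & Ht2 & _) Hsi v Hv.
    destruct (classic (exists eta, eta ∈ gamma i /\ v = a i eta))
      as [(eta & He & ->)|N]; [now apply Ht1|].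
    rewrite Ht2 by exact N. now apply Hsi. }
  assert (Hb : ae2 (fun beta i => forall eta, eta ∈ beta -> eta ∈ gamma i ->
    in_V beta (t i (a i eta)))).
  { apply (ae2_diagonal (P := fun eta beta i => eta ∈ gamma i ->
      in_V beta (t i (a i eta)))).
    intros eta _. destruct (nq_ultra HQ (fun i => eta ∈ gamma i)) as [H|N].
    - refine (ae2_imp (ae2_in_V (x := fun i => t i (a i eta)) _) _).
      + apply (nq_imp HQ H), (nq_mono HQ Ht). intros i (Ht1 & _) He. now apply Ht1.
      + apply ae2_all. auto.
    - apply (ae2_imp (ae2_right N)), ae2_all. tauto. }
  apply (ae2_imp (IH Hgood)), (ae2_imp (ae2_right Ht)), (ae2_imp Hb),
    (ae2_imp (ae2_right HL)), (ae2_imp ae2_good), ae2_all.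
  intros beta i Hg HLi Hbi (_ & Ht2 & Ht3) Hi chi Hr HLc.
  destruct (restriction_ex_inv (good_ordinal Hg) (proj1 (proj2 Hg)) HLi Hr HLc)
    as (psi' & Hr' & HL' & _ & Hsat).
  apply Hsat. exists (t i). repeat split; auto.
  now apply (Hi psi' Hr' HL').
Qed.

(** The witnesses found below [beta] have values in [V_beta], so each coordinate
    is almost always constant; the constants assemble into a witness at [i]. *)
Lemma reflects_ex_false :
  ae2 (fun beta i => exists chi, restriction b i beta
      (Ex (gamma i) (fun z : el (gamma i) => a i (val z)) (psi i)) chi /\
    in_L beta chi /\ sat beta chi (s i)) ->
  Q (fun i => sat i (Ex (gamma i) (fun z : el (gamma i) => a i (val z)) (psi i)) (s i)).
Proof.
  intros H.
  destruct (ae2_choice (R := fun beta i t => exists psi',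
      restriction b i beta (psi i) psi' /\ in_L beta psi' /\
      (forall eta, eta ∈ beta -> eta ∈ gamma i -> in_V beta (t (a i eta))) /\
      (forall v, v ∈ beta -> (~ exists eta, eta ∈ gamma i /\ v = a i eta) ->
         t v = s i v) /\
      sat beta psi' t)) as [t Ht].
  { apply (ae2_imp H), (ae2_imp (ae2_right HL)), (ae2_imp ae2_good), ae2_all.
    intros beta i Hg HLi (chi & Hr & HLc & Hc).
    destruct (restriction_ex_inv (good_ordinal Hg) (proj1 (proj2 Hg)) HLi Hr HLc)
      as (psi' & Hr' & HL' & _ & Hsat).
    apply Hsat in Hc. destruct Hc as (t & Ht1 & Ht2 & Ht3). now exists t, psi'. }
  assert (Hc : forall eta, eta ∈ kappa -> exists c,
    Q (fun i => eta ∈ gamma i -> in_V i c) /\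
    ae2 (fun beta i => eta ∈ gamma i -> t beta i (a i eta) = c)).
  { intros eta He. destruct (nq_ultra HQ (fun i => eta ∈ gamma i)) as [Hg|N].
    - destruct (ae2_in_V_constant (x := fun beta i => t beta i (a i eta)))
        as (c & Hc & Hc').
      + apply (ae2_imp Ht), (ae2_imp (ae2_right Hg)),
          (ae2_imp (ae2_left (nq_large HW He))), ae2_all.
        intros beta i Heb Hei (psi' & _ & _ & H' & _). now apply H'.
      + exists c. split.
        * apply (nq_mono HQ Hc). auto.
        * apply (ae2_imp Hc'), ae2_all. auto.
    (* Here [eta] is almost never an index of the block, so any default value will do. *)
    - exists eta. split.
      + apply (nq_mono HQ N). tauto.
      + apply (ae2_imp (ae2_right N)), ae2_all. tauto. }
  destruct (total_choice (fun eta c =>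
    Q (fun i => eta ∈ gamma i -> in_V i c) /\
    ae2 (fun beta i => eta ∈ gamma i -> t beta i (a i eta) = c)) V_inhabited)
    as [c Hc0].
  assert (Hc1 := nq_diagonal HQ (P := fun eta i => eta ∈ gamma i -> in_V i (c eta))
    (fun eta He => proj1 (Hc0 eta (Hc eta He)))).
  assert (Hc2 := ae2_diagonal (P := fun eta beta i => eta ∈ gamma i ->
    t beta i (a i eta) = c eta) (fun eta He => proj2 (Hc0 eta (Hc eta He)))).
  (* The assembled witness takes the value [c eta] at the quantified variable [a i eta] and follows
     [s i] at all others. *)
  destruct (total_choice (fun (p : V * V) x =>
    (exists eta, eta ∈ gamma (fst p) /\ snd p = a (fst p) eta /\ x = c eta) \/
    ((~ exists eta, eta ∈ gamma (fst p) /\ snd p = a (fst p) eta) /\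
      x = s (fst p) (snd p))) V_inhabited) as [t0 Ht0].
  pose (t' := fun i v => t0 (i, v)).
  assert (Ht' : forall i v,
    (exists eta, eta ∈ gamma i /\ v = a i eta /\ t' i v = c eta) \/
    ((~ exists eta, eta ∈ gamma i /\ v = a i eta) /\ t' i v = s i v)).
  { intros i v. apply (Ht0 (i, v)). simpl.
    destruct (classic (exists eta, eta ∈ gamma i /\ v = a i eta))
      as [(eta & He & E)|N].
    - exists (c eta). left. now exists eta.
    - exists (s i v). now right. }
  (* The block has length at most [i], so the diagonal intersection [Hc1] reaches all its
     coordinates. *)
  assert (Hbound : Q (fun i => forall eta, eta ∈ gamma i -> eta ∈ i)).
  { apply (nq_imp HQ HL), (nq_mono HQ (nq_ordinal HQ)).
    intros i Oi ([-> | Hg] & _) eta He; [exact He|].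
    exact (ordinal_trans Oi He Hg). }
  assert (Hgood : Q (fun i => forall v, v ∈ i -> in_V i (t' i v))).
  { apply (nq_imp HQ Hs), (nq_imp HQ Hbound), (nq_mono HQ Hc1).
    intros i Hci Hbi Hsi v Hv.
    destruct (Ht' i v) as [(eta & He & -> & ->)|[_ ->]]; auto. }
  apply NNPP. intros N. apply (nq_not HQ) in N.
  destruct (ae2_witness (P := fun _ _ => False)) as (_ & _ & _ & []).
  apply (ae2_imp (IH Hgood)), (ae2_imp Ht), (ae2_imp (ae2_right HL)),
    (ae2_imp (ae2_right N)), (ae2_imp (ae2_right Hbound)),
    (ae2_imp (ae2_right Hc1)), (ae2_imp Hc2), (ae2_imp ae2_good), ae2_all.
  intros beta i Hg Hc2i Hc1i Hbi Ni HLi (psi' & Hr & HL' & _ & Hoff & Hsat) Hi.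
  assert (Oi := good_ordinal Hg).
  apply Ni. exists (t' i). split; [|split].
  - intros [eta He]. simpl.
    destruct (Ht' i (a i eta)) as [(eta' & He' & _ & ->)|[N' _]].
    + apply Hc1i; auto.
    + destruct N'. now exists eta.
  - intros v Hv. destruct (Ht' i v) as [(eta & He & E & _)|[_ ->]]; [|reflexivity].
    destruct Hv. now exists (exist _ eta He).
  (* Below [beta] the assembled witness agrees with the one found for [beta] and [i], so it
     satisfies [psi'], and the induction hypothesis lifts this to V_i. *)
  - apply (Hi psi' Hr HL'). apply (sat_agree_in_L (s := t beta i)); auto.
    intros v Hv. destruct (Ht' i v) as [(eta & He & -> & ->)|[N' ->]].
    + apply Hc2i; [|exact He]. exact (ex_var_below Oi (proj1 (proj2 Hg)) HLi He Hv).
    + now apply Hoff.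
Qed.

End Exists.

(** When the formula fails at almost every [i], the restrictions are almost always false as well,
    since otherwise [reflects_ex_false] would make it true. *)
Lemma reflects_ex (gamma : V -> V) (a : V -> V -> V) (psi : V -> form V) :
  Q (fun i => in_L i (Ex (gamma i) (fun z : el (gamma i) => a i (val z)) (psi i))) ->
  reflects psi ->
  reflects (fun i => Ex (gamma i) (fun z : el (gamma i) => a i (val z)) (psi i)).
Proof.
  intros HL IH s Hs.
  destruct (nq_ultra HQ (fun i => sat i
    (Ex (gamma i) (fun z : el (gamma i) => a i (val z)) (psi i)) (s i))) as [T|N].
  - destruct (nq_choice HQ T) as [t Ht].
    assert (Hsat := reflects_ex_true HL IH Hs (t := t)).
    refine (ae2_imp (Hsat _) _).
    + apply (nq_mono HQ Ht). intros i (Ht1 & Ht2 & Ht3). split; [|split].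
      * intros eta He. exact (Ht1 (exist _ eta He)).
      * intros v Hv. apply Ht2. intros [[eta He] E]. apply Hv. now exists eta.
      * exact Ht3.
    + apply (ae2_imp (ae2_right T)), ae2_all. intros beta i Ti Hi chi Hr HLc.
      split; [now intros _|]. intros _. now apply Hi.
  - destruct (classic (ae2 (fun beta i => exists chi, restriction b i beta
      (Ex (gamma i) (fun z : el (gamma i) => a i (val z)) (psi i)) chi /\
      in_L beta chi /\ sat beta chi (s i)))) as [H|H].
    + apply (reflects_ex_false HL IH Hs) in H.
      destruct (nq_witness HQ (nq_and HQ H N)) as [i [H1 H2]]. easy.
    + apply ae2_not in H. apply (ae2_imp H), (ae2_imp (ae2_right N)), ae2_all.
      intros beta i Ni Hi chi Hr HLc. split; [|easy].
      intros Hc. destruct Hi. now exists chi.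
Qed.

Lemma ae2_reflects (phi : V -> form V) :
  Q (fun i => in_L i (phi i)) -> reflects phi.
Proof.
  revert phi. apply (family_ind HQ Rk
    (P := fun phi => Q (fun i => in_L i (phi i)) -> reflects phi)).
  intros phi IH HL.
  (* [family_shape] describes [phi] only almost everywhere, so the claim has to be invariant under
     almost-everywhere equality. *)
  assert (Hae : forall phi', Q (fun i => phi i = phi' i) ->
    (Q (fun i => in_L i (phi' i)) -> reflects phi') -> reflects phi).
  { intros phi' E H s Hs. refine (ae2_imp (H _ s Hs) _).
    - apply (nq_imp HQ HL), (nq_mono HQ E). now intros i ->.
    - apply (ae2_imp (ae2_right E)), ae2_all. now intros beta i ->. }
  destruct (family_shape phi) as [[xy E]|[[xy E]|[[psi E]|[(xi & f & E)|
    (gamma & a & psi & E)]]]]; apply (Hae _ E); intros HL'.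
  - intros s Hs. apply ae2_all. now intros beta i chi ->.
  - intros s Hs. apply ae2_all. now intros beta i chi ->.
  - intros s Hs. refine (ae2_imp (IH psi _ HL' s Hs) _).
    + apply (nq_mono HQ E). now intros i ->.
    + apply ae2_all. intros beta i H chi (psi' & Hr & ->) HLc.
      simpl. now rewrite (H psi' Hr HLc).
  - apply reflects_conj; [exact HL'|]. intros z Hz. apply IH.
    + apply (nq_imp HQ Hz), (nq_mono HQ E). intros i -> Hi.
      now exists (exist _ (z i) Hi).
    + apply (nq_imp HQ Hz), (nq_mono HQ HL'). intros i [_ H] Hi.
      exact (H (exist _ (z i) Hi)).
  - apply reflects_ex; [exact HL'|]. apply IH.
    + apply (nq_mono HQ E). now intros i ->.
    + apply (nq_mono HQ HL'). intros i H. apply H.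
Qed.

Lemma ae2_models (phi : V -> form V) :
  Q (fun i => in_L i (phi i) /\ sentence (phi i) /\ models i (phi i)) ->
  ae2 (fun beta i => exists chi,
    restriction b i beta (phi i) chi /\ models beta chi).
Proof.
  intros H.
  assert (HL : Q (fun i => in_L i (phi i))) by (apply (nq_mono HQ H); tauto).
  (* The empty set is a value available in every level with a nonempty index, hence the constant
     assignment [e]. *)
  destruct (infinity V) as (_ & (e & _ & He) & _).
  assert (Hs : Q (fun i => forall v, v ∈ i -> in_V i e)).
  { apply (nq_all HQ). intros i v Hv. now apply in_V_empty with v. }
  apply (ae2_imp (ae2_restriction HL)),
    (ae2_imp (@ae2_reflects phi HL (fun _ _ => e) Hs)),
    (ae2_imp (ae2_right H)), (ae2_imp ae2_good), ae2_all.
  intros beta i (Ri & Hb & _) (HLi & Hsent & Hm) Hi (chi & Hr & HLc).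
  exists chi. split; [exact Hr|]. intros s.
  apply (sat_agree beta (phi := chi) (s := fun _ => e) (s' := s)).
  - intros v Hv. destruct (Hsent v).
    exact (restriction_free hb Ri Hb HLi Hr HLc Hv).
  - apply (Hi chi Hr HLc). apply Hm.
Qed.

End Reflection.

Theorem proposition4p4 (V : ZFC) (b : V -> V -> V -> V)
    (hb : bijection_choice b) (kappa U : V)
    (hkappa : measurable kappa) (hU : normal_measure kappa U) :
  indescribable b kappa /\
  sep_in kappa (fun alpha => indescribable b alpha) U.
Proof.
  destruct hkappa as (Ck & _). assert (Ok := proj1 Ck).
  assert (Rk := measure_regular Ok hU Ck).
  assert (HW := nq_measure Ok hU).
  assert (HWk := ae_kappa hU).
  assert (Reg := nq_regular HW Rk).
  split.
  - split; [exact Rk|]. intros phi HL Hs Hm.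
    assert (HQ := nq_at Ok).
    assert (H := ae2_models hb HW HQ HWk Rk (phi := fun _ => phi)
      (conj HL (conj Hs Hm))).
    destruct (nq_witness HW (nq_and HW HWk (nq_and HW Reg H)))
      as (alpha & Ha & Ra & Hc).
    exists alpha. split; [exact Ha|]. split; [apply Ra|exact Hc].
  - apply NNPP. intros N. apply (nq_not HW) in N.
    destruct (nq_choice HW (R := fun i phi =>
      (in_L i phi /\ sentence phi /\ models i phi) /\
      forall alpha, alpha ∈ i -> cardinal alpha ->
        ~ exists chi, restriction b i alpha phi chi /\ models alpha chi)) as [phi Hphi].
    { apply (nq_imp HW N), (nq_mono HW Reg). intros i Ri Ni.
      apply NNPP. intros N'. apply Ni. split; [exact Ri|]. intros phi HL Hs Hm.
      apply NNPP. intros N''. apply N'. exists phi. split; [easy|].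
      intros alpha Ha Ca Hc. apply N''. now exists alpha. }
    assert (H := ae2_models hb HW HW HWk Rk (phi := phi)
      (nq_mono HW Hphi (fun i Hi => proj1 Hi))).
    destruct (nq_witness HW (nq_and HW HWk (nq_and HW Reg H)))
      as (alpha & Ha & Ra & Hc).
    (* [alpha] was fixed first and reflects almost every [phi i]; an [i] above it at which [phi i]
       is a counterexample gives the contradiction. *)
    destruct (nq_witness HW (nq_and HW (nq_large HW Ha) (nq_and HW Hphi Hc)))
      as (i & Hai & [_ Hi] & Hc').
    exact (Hi alpha Hai (proj1 Ra) Hc').
Qed.
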